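(* Assume that the communication graph is undirected and connected with symmetric, nonnegative, doubly stochastic weight matrix $W$, that each $f_i$ is $L$-smooth, that the Riemannian gradient samples are unbiased with variance bounded by $\sigma^2$, and that they are uniformly bounded in norm by $A_1$ (all as detailed in the context). Consider Algorithm 1 (described in the context) with $t\ge\lceil\log_{\sigma_2}(\frac{1}{2\sqrt N})\rceil$, step size $\alpha$ with $0<\alpha\le\min\{1,\frac1M,\frac{\Phi}{L_t}\}$, and step size $\beta$ with $$0\le\beta\le\bar\beta:=\min\Big\{\frac{1-\rho_t}{10A+L_G}\delta_1,\ \frac{\alpha\delta_1}{5(10A+L_G)}\Big\}.$$ If the initial point satisfies $\mathbf{X}_0\in\mathcal{S}$, then for all $k\ge0$: (i) $\mathbf{X}_k\in\mathcal{S}$; (ii) $Y_{i,k}$ is uniformly bounded: $\|Y_{i,k}\|_F\le10A+L_G$ for all $i\in\mathcal{N}$.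
   Context: Manifold. $\mathcal{M}=\mathrm{St}(n,r)=\{X\in\mathbb{R}^{n\times r}:X^\top X=I_r\}$ with tangent space $T_X\mathcal{M}=\{u\in\mathbb{R}^{n\times r}:X^\top u+u^\top X=0\}$, inner product $\langle u,v\rangle=\mathrm{tr}(u^\top v)$, and orthogonal projection $\mathcal{P}_{T_X\mathcal{M}}(Y)=Y-\frac12X(X^\top Y+Y^\top X)$. For differentiable $\phi$, $\mathrm{grad}\,\phi(X)=\mathcal{P}_{T_X\mathcal{M}}(\nabla\phi(X))$. The polar retraction is $\mathcal{R}_X(v)=(X+v)(I_r+v^\top v)^{-1/2}$, $v\in T_X\mathcal{M}$, and $M>0$ is a constant with $\|\mathcal{R}_X(v)-(X+v)\|_F\le M\|v\|_F^2$ for all $X\in\mathrm{St}(n,r)$, $v\in T_X\mathcal{M}$. For $\mathbf{X}=[X_1^\top,\dots,X_N^\top]^\top\in\mathrm{St}(n,r)^N$ the induced arithmetic mean (IAM) is $\hat X\in\arg\min_{Y\in\mathrm{St}(n,r)}\sum_{i=1}^N\|Y-X_i\|_F^2$, and $\hat{\mathbf{X}}=(\mathbf{1}_N\otimes I_n)\hat X$. Problem. $N$ agents, $\mathcal{N}=\{1,\dots,N\}$, minimize $f=\frac1N\sum_{i=1}^Nf_i$ over $\mathrm{St}(n,r)$, where $f_i(X)=\mathbb{E}_{\xi_i}F_i(X,\xi_i)$. Each $f_i$ is differentiable on $\mathbb{R}^{n\times r}$ with $\|\nabla f_i(X)-\nabla f_i(Y)\|_F\le L\|X-Y\|_F$.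 Put $L_n=\max_{i}\max_{X\in\mathrm{St}(n,r)}\|\nabla f_i(X)\|_2$ and $L_G=L+2L_n$. Network. The graph $\mathcal{G}=(\mathcal{N},\mathcal{E})$ is undirected and connected; $W=(w_{ij})\in\mathbb{R}^{N\times N}$ has $w_{ij}>0$ if $(i,j)\in\mathcal{E}$ or $i=j$, $w_{ij}=0$ otherwise, $W=W^\top$, $W\mathbf{1}_N=\mathbf{1}_N$. $W^t_{ij}$ is the $(i,j)$ entry of $W^t$; $\sigma_2\in[0,1)$ is the second largest singular value of $W$; $L_t=1-\sigma_N(W^t)\in(0,2]$ with $\sigma_N(W^t)$ the smallest eigenvalue of $W^t$. (If $\sigma_2=0$ the condition on $t$ is just $t\ge1$.) Local region. $\delta_1,\delta_2>0$ are given constants with $\delta_1\le\frac{1}{5\sqrt r}\delta_2$, $\delta_2\le\frac16$, and $\mathcal{S}$ is the set of $\mathbf{X}\in\mathrm{St}(n,r)^N$ with $\|\mathbf{X}-\hat{\mathbf{X}}\|_F^2\le N\delta_1^2$ and $\max_i\|X_i-\hat X\|_F\le\delta_2$. $\Phi$ is a constant with $1\le\Phi\le 2-\max_i\|X_i-\hat X\|_F^2$ for all $\mathbf{X}\in\mathcal{S}$ (e.g. $\Phi=2-\delta_2^2$). $\rho_t=\sqrt{1-(\alpha L_t\Phi-\alpha^2L_t^2)}$. Stochastic oracle. $G_i(X,\xi_i)\in T_X\mathcal{M}$ satisfies, for all $i$ and $X\in\mathrm{St}(n,r)$: $E_{\xi_i}[G_i(X,\xi_i)]=\mathrm{grad}f_i(X)$,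 $E_{\xi_i}[\|G_i(X,\xi_i)-\mathrm{grad}f_i(X)\|_F^2]\le\sigma^2$, and $\|G_i(X,\xi_i)\|_F\le A_1$ for all $\xi_i$ in the support. $A_2$ is a constant with $\max_{X\in\mathrm{St}(n,r)}\|\nabla f_i(X)\|_F\le A_2$ for all $i$; $A=\max\{A_1,A_2\}$. Algorithm 1. Sample sizes $N_k$ are positive integers; $F_i(X_{i,k}):=\frac{1}{N_k}\sum_{j=1}^{N_k}G_i(X_{i,k},\xi_{i,k}^{[j]})$, where $\xi_{i,k}^{[j]}$, $j=1,\dots,N_k$, are i.i.d. realizations of $\xi_i$ drawn independently of the past. Given $\mathbf{X}_0$, $Y_{i,0}=F_i(X_{i,0})$, and integer $t\ge1$, for $k=0,1,\dots$ and all $i$: $v_{i,k}=\mathcal{P}_{T_{X_{i,k}}\mathcal{M}}Y_{i,k}$; $X_{i,k+1}=\mathcal{R}_{X_{i,k}}\big(\alpha\mathcal{P}_{T_{X_{i,k}}\mathcal{M}}[\sum_{j=1}^NW_{ij}^tX_{j,k}]-\beta v_{i,k}\big)$; $Y_{i,k+1}=\sum_{j=1}^NW_{ij}^tY_{j,k}+F_i(X_{i,k+1})-F_i(X_{i,k})$. Stack $\mathbf{X}_k=[X_{1,k}^\top,\dots,X_{N,k}^\top]^\top$. *)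

(* Defs.v *)
From HB Require Import structures.
From mathcomp Require Import all_boot all_order all_algebra.
From mathcomp Require Import all_classical all_reals all_analysis.

Set Implicit Arguments.
Unset Strict Implicit.
Unset Printing Implicit Defensive.

Import Order.TTheory GRing.Theory Num.Theory.
Import numFieldNormedType.Exports.

Local Open Scope classical_set_scope.
Local Open Scope ring_scope.

Section Matrices.
Variable R : realType.
Implicit Types n r : nat.

Definition inner n r (u v : 'M[R]_(n, r)) : R := \tr (u^T *m v).

(* Frobenius norm; the library norm [`|u|] on matrices is the max norm. *)
Definition normF n r (u : 'M[R]_(n, r)) : R := Num.sqrt (inner u u).

(* Spectral norm, i.e. the operator norm for the Euclidean norms. *)
Definition norm2 n r (A : 'M[R]_(n, r)) : R :=
  sup [set normF (A *m x) | x in [set x : 'cV[R]_r | normF x <= 1]].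

(* Matrix of the partial derivatives of [f] at [X]: this is the gradient for
   [inner] when [f] is differentiable. *)
Definition egrad n r (f : 'M[R]_(n, r) -> R) (X : 'M[R]_(n, r)) : 'M[R]_(n, r) :=
  \matrix_(a, b) 'D_(delta_mx a b) f X.

Definition psd r (S : 'M[R]_r) : Prop :=
  S^T = S /\ forall x : 'cV[R]_r, 0 <= inner x (S *m x).

(* A^{-1/2} for symmetric positive definite A: the positive semidefinite square
   root of A^{-1}, which exists and is unique (the value is 0 if there is none). *)
Definition inv_sqrtmx r (A : 'M[R]_r) : 'M[R]_r :=
  xget 0 [set S : 'M[R]_r | psd S /\ S *m S = invmx A].

(* [s] lists the singular values of [A] with multiplicity, in decreasing order. *)
Definition singular_values n (A : 'M[R]_n) (s : seq R) : Prop :=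
  [/\ sorted (fun x y => y <= x) s, all (fun x => 0 <= x) s &
      char_poly (A^T *m A) = \prod_(x <- s) ('X - (x ^+ 2)%:P)].

Definition second_singular_value n (A : 'M[R]_n) (sigma2 : R) : Prop :=
  exists2 s, singular_values A s & sigma2 = s`_1.

Definition smallest_eigenvalue n (A : 'M[R]_n) (l : R) : Prop :=
  eigenvalue A l /\ forall m, eigenvalue A m -> l <= m.

End Matrices.

Section StiefelManifold.
Variable R : realType.
Variables n r : nat.
Implicit Types X Y u v : 'M[R]_(n, r).

Definition St : set 'M[R]_(n, r) := [set X | X^T *m X = 1%:M].

Definition tangent X : set 'M[R]_(n, r) :=
  [set u | X^T *m u + u^T *m X = 0].

Definition projT X Y : 'M[R]_(n, r) :=
  Y - 2^-1 *: (X *m (X^T *m Y + Y^T *m X)).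

Definition rgrad (f : 'M[R]_(n, r) -> R) X : 'M[R]_(n, r) :=
  projT X (egrad f X).

Definition polar_retr X v : 'M[R]_(n, r) :=
  (X + v) *m inv_sqrtmx (1%:M + v^T *m v).

Definition second_order_retr (M : R) : Prop :=
  forall X v, St X -> tangent X v ->
    normF (polar_retr X v - (X + v)) <= M * normF v ^+ 2.

(* A point of St(n, r)^N, usually stacked as an Nn x r matrix, is here the
   family of its blocks [X : 'I_N -> 'M_(n, r)]; the squared Frobenius norm of
   the stack is the sum of those of the blocks. *)

Definition is_iam N (X : 'I_N -> 'M[R]_(n, r)) (Xh : 'M[R]_(n, r)) : Prop :=
  St Xh /\ forall Y, St Y ->
    \sum_i normF (Xh - X i) ^+ 2 <= \sum_i normF (Y - X i) ^+ 2.

Definition near_iam N (delta1 delta2 : R) (X : 'I_N -> 'M[R]_(n, r))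
    (Xh : 'M[R]_(n, r)) : Prop :=
  \sum_i normF (X i - Xh) ^+ 2 <= N%:R * delta1 ^+ 2 /\
  forall i, normF (X i - Xh) <= delta2.

Definition local_region N (delta1 delta2 : R) : set ('I_N -> 'M[R]_(n, r)) :=
  [set X | (forall i, St (X i)) /\
           exists2 Xh, is_iam X Xh & near_iam delta1 delta2 X Xh].

End StiefelManifold.

Section Network.
Variable R : realType.

Definition connected_graph N (e : rel 'I_N) : Prop :=
  symmetric e /\ forall i j, connect e i j.

Definition weight_matrix N (e : rel 'I_N) (W : 'M[R]_N) : Prop :=
  [/\ forall i j, e i j || (i == j) -> 0 < W i j,
      forall i j, ~~ (e i j || (i == j)) -> W i j = 0,
      W^T = W &
      W *m (const_mx 1 : 'cV[R]_N) = const_mx 1].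

End Network.

Section Problem.
Variables (R : realType) (n r N : nat).
Variables (d : 'I_N -> measure_display) (Xi : forall i, measurableType (d i)).
Variable law : forall i, probability (Xi i) R.

Definition expected_objective (F : forall i, 'M[R]_(n, r) -> Xi i -> R)
    (f : 'I_N -> 'M[R]_(n, r) -> R) : Prop :=
  forall i X, (law i).-integrable setT (EFin \o F i X) /\
    ('E_(law i)[F i X] = (f i X)%:E)%E.

Definition L_smooth (L : R) (f : 'M[R]_(n, r) -> R) : Prop :=
  (forall X, differentiable f X) /\
  forall X Y, normF (egrad f X - egrad f Y) <= L * normF (X - Y).

Definition max_grad_norm2 (f : 'I_N -> 'M[R]_(n, r) -> R) : R :=
  sup [set norm2 (egrad (f p.1) p.2) | p in [set p | @St R n r p.2]].

(* The bound is required on a set [supp i] of full measure, which plays the role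
   of the support of the law of xi_i on the abstract sample space [Xi i]. *)
Record oracle (f : 'I_N -> 'M[R]_(n, r) -> R)
    (G : forall i, 'M[R]_(n, r) -> Xi i -> 'M[R]_(n, r))
    (supp : forall i, set (Xi i)) (sigma A1 : R) : Prop := Oracle {
  supp_full : forall i, measurable (supp i) /\ law i (supp i) = 1%E ;
  oracle_measurable : forall i X a b, St X ->
    measurable_fun setT (fun xi => G i X xi a b) ;
  oracle_tangent : forall i X xi, St X -> supp i xi -> tangent X (G i X xi) ;
  oracle_unbiased : forall i X a b, St X ->
    ('E_(law i)[fun xi => G i X xi a b] = (rgrad (f i) X a b)%:E)%E ;
  oracle_variance : forall i X, St X ->
    ('E_(law i)[fun xi => (normF (G i X xi - rgrad (f i) X) ^+ 2)%R]
      <= (sigma ^+ 2)%:E)%E ;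
  oracle_bounded : forall i X xi, St X -> supp i xi -> normF (G i X xi) <= A1
}.

Section Sampling.
Variables (d0 : measure_display) (Omega : measurableType d0).
Variable P : probability Omega R.
Variable Nk : nat -> nat.
(* [smp i k j] is the j-th sample (counted from 0) drawn by agent i at iteration
   k; only the indices j < Nk k are used. *)
Variable smp : forall i : 'I_N, nat -> nat -> Omega -> Xi i.

(* The sigma-algebra generated by the samples of all agents before iteration k. *)
Definition past (k : nat) : set (set Omega) :=
  <<s [set C | exists i l j (B : set (Xi i)),
       [/\ (l < k)%N, (j < Nk l)%N, measurable B & C = smp i l j @^-1` B]] >>.

(* Each batch of agent i at iteration k is i.i.d. and jointly independent of the
   past. Taking some of the [B j] to be [setT] gives the product rule for all
   subfamilies. No independence between agents within an iteration is assumed. *)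
Record iid_samples : Prop := IidSamples {
  smp_measurable : forall i k j, (j < Nk k)%N -> measurable_fun setT (smp i k j) ;
  smp_law : forall i k j (B : set (Xi i)), (j < Nk k)%N -> measurable B ->
    P (smp i k j @^-1` B) = law i B ;
  smp_indep : forall i k (B : 'I_(Nk k) -> set (Xi i)) C,
    (forall j, measurable (B j)) -> past k C ->
    (P (C `&` \bigcap_(j in setT) smp i k (j : 'I_(Nk k)) @^-1` B j)
      = P C * \prod_(j < Nk k) P (smp i k j @^-1` B j))%E
}.

Variable G : forall i, 'M[R]_(n, r) -> Xi i -> 'M[R]_(n, r).

Definition batch_grad (w : Omega) (k : nat) (i : 'I_N) (X : 'M[R]_(n, r)) :
    'M[R]_(n, r) :=
  (Nk k)%:R^-1 *: \sum_(j < Nk k) G X (smp i k j w).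

Variables (Wt : 'M[R]_N) (alpha beta : R) (X0 : 'I_N -> 'M[R]_(n, r)).

(* The pair of families (X_{.,k}, Y_{.,k}) along the sample path [w]. *)
Fixpoint iterate (w : Omega) (k : nat) :
    ('I_N -> 'M[R]_(n, r)) * ('I_N -> 'M[R]_(n, r)) :=
  match k with
  | 0 => (X0, fun i => batch_grad w 0 i (X0 i))
  | k'.+1 =>
    let X := (iterate w k').1 in
    let Y := (iterate w k').2 in
    let v i := projT (X i) (Y i) in
    let X' i := polar_retr (X i)
      (alpha *: projT (X i) (\sum_j Wt i j *: X j) - beta *: v i) in
    (X', fun i => \sum_j Wt i j *: Y j
                  + batch_grad w k'.+1 i (X' i) - batch_grad w k' i (X i))
  end.

End Sampling.
End Problem.

(* Main.v *)
Require Import Defs.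
From mathcomp Require Import all_boot all_order all_algebra.
From mathcomp Require Import all_classical all_reals all_analysis.
From mathcomp Require Import ring lra complex.

Set Implicit Arguments.
Unset Strict Implicit.
Unset Printing Implicit Defensive.

Import Order.TTheory GRing.Theory Num.Theory.
Import numFieldNormedType.Exports.

Local Open Scope classical_set_scope.
Local Open Scope ring_scope.

(* Write D_i = X_i - Xh for an induced arithmetic mean Xh of X.  First-order
   optimality of Xh along polar retractions gives
     mean X = Xh (1 - (1/2) mean (D_i^T D_i)),
   so the Euclidean mean is within delta1^2 / 2 of Xh, and Xh depends on the
   Euclidean mean in a Lipschitz way with constant 1 / (1 - delta1^2 / 2).
   The polar retraction is nonexpansive towards points of St(n, r), and projecting
   the mixing direction costs only a quadratic term, so the distance of agent i to
   Xh after one step is at most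
     (1 - alpha) |D_i| + alpha (|sum_j W^t_ij X_j - mean X| + quadratic terms)
       + beta |v_i|.
   The condition on t makes the rows of W^t - 11^T/N have l1-norm at most 1/2 and
   its operator norm at most 1/(2 sqrt N) <= 3/8; since beta |v_i| <= alpha delta1 / 5,
   both the quadratic mean and the maximum of these distances stay below their
   thresholds, with room in the maximum for the drift of Xh, which is second order
   in delta1 except for the beta term. *)


(** * Frobenius inner product and norm *)

Section FrobeniusNorm.
Variable R : realType.
Implicit Types (n r p : nat) (a : R).

Lemma innerE n r (u v : 'M[R]_(n, r)) : inner u v = \sum_i \sum_j u i j * v i j.
Proof.
rewrite /inner /mxtrace exchange_big; apply: eq_bigr => j _.
by rewrite mxE; apply: eq_bigr => i _; rewrite mxE.
Qed.

Lemma innerC n r (u v : 'M[R]_(n, r)) : inner u v = inner v u.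
Proof. by rewrite /inner -mxtrace_tr trmx_mul trmxK. Qed.

Lemma innerDr n r (u v w : 'M[R]_(n, r)) : inner u (v + w) = inner u v + inner u w.
Proof. by rewrite /inner mulmxDr mxtraceD. Qed.

Lemma innerDl n r (u v w : 'M[R]_(n, r)) : inner (v + w) u = inner v u + inner w u.
Proof. by rewrite !(innerC _ u) innerDr. Qed.

Lemma innerZr n r a (u v : 'M[R]_(n, r)) : inner u (a *: v) = a * inner u v.
Proof. by rewrite /inner -scalemxAr mxtraceZ. Qed.

Lemma innerZl n r a (u v : 'M[R]_(n, r)) : inner (a *: u) v = a * inner u v.
Proof. by rewrite innerC innerZr innerC. Qed.

Lemma innerNr n r (u v : 'M[R]_(n, r)) : inner u (- v) = - inner u v.
Proof. by rewrite -scaleN1r innerZr mulN1r. Qed.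

Lemma innerNl n r (u v : 'M[R]_(n, r)) : inner (- u) v = - inner u v.
Proof. by rewrite innerC innerNr innerC. Qed.

Lemma innerBr n r (u v w : 'M[R]_(n, r)) : inner u (v - w) = inner u v - inner u w.
Proof. by rewrite innerDr innerNr. Qed.

Lemma innerBl n r (u v w : 'M[R]_(n, r)) : inner (v - w) u = inner v u - inner w u.
Proof. by rewrite innerDl innerNl. Qed.

Lemma inner0r n r (u : 'M[R]_(n, r)) : inner u 0 = 0.
Proof. by rewrite -(scale0r 0) innerZr mul0r. Qed.

Lemma inner_sumr n r (I : Type) (s : seq I) (P : pred I) (F : I -> 'M[R]_(n, r)) u :
  inner u (\sum_(i <- s | P i) F i) = \sum_(i <- s | P i) inner u (F i).
Proof.
elim/big_rec2: _ => [|i x y _ <-]; [exact: inner0r | exact: innerDr].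
Qed.

Lemma inner_mull n p r (u : 'M[R]_(n, p)) (v : 'M[R]_(p, r)) (w : 'M[R]_(n, r)) :
  inner (u *m v) w = inner v (u^T *m w).
Proof. by rewrite /inner trmx_mul mulmxA. Qed.

Lemma inner_mulr n p r (u : 'M[R]_(n, r)) (v : 'M[R]_(n, p)) (w : 'M[R]_(p, r)) :
  inner u (v *m w) = inner (v^T *m u) w.
Proof. by rewrite innerC inner_mull innerC. Qed.

Lemma inner_trmx n r (u v : 'M[R]_(n, r)) : inner u^T v^T = inner u v.
Proof. by rewrite /inner trmxK mxtrace_mulC -mxtrace_tr trmx_mul trmxK. Qed.

Lemma inner_ge0 n r (u : 'M[R]_(n, r)) : 0 <= inner u u.
Proof. by rewrite innerE; do 2!apply: sumr_ge0 => ? _; rewrite -expr2 sqr_ge0. Qed.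

Lemma inner_eq0 n r (u : 'M[R]_(n, r)) : (inner u u == 0) = (u == 0).
Proof.
apply/eqP/eqP => [|->]; last exact: inner0r.
rewrite innerE => h; apply/matrixP => i j; rewrite mxE.
have ge0 (k : 'I_n) : true -> 0 <= \sum_l u k l * u k l.
  by move=> _; apply: sumr_ge0 => l _; rewrite -expr2 sqr_ge0.
have /(_ i isT) {}h := psumr_eq0P ge0 h.
have ge0' (l : 'I_r) : true -> 0 <= u i l * u i l.
  by rewrite -expr2 sqr_ge0.
by have /(_ j isT)/eqP := psumr_eq0P ge0' h; rewrite mulf_eq0 orbb => /eqP.
Qed.

Lemma normF_ge0 n r (u : 'M[R]_(n, r)) : 0 <= normF u.
Proof. exact: sqrtr_ge0. Qed.

Lemma sqr_normF n r (u : 'M[R]_(n, r)) : normF u ^+ 2 = inner u u.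
Proof. by rewrite sqr_sqrtr ?inner_ge0. Qed.

Lemma normF_eq0 n r (u : 'M[R]_(n, r)) : (normF u == 0) = (u == 0).
Proof. by rewrite -inner_eq0 -sqr_normF sqrf_eq0. Qed.

Lemma normF0 n r : normF (0 : 'M[R]_(n, r)) = 0.
Proof. by apply/eqP; rewrite normF_eq0. Qed.

Lemma normFN n r (u : 'M[R]_(n, r)) : normF (- u) = normF u.
Proof. by rewrite /normF innerNl innerNr opprK. Qed.

Lemma normF_distC n r (u v : 'M[R]_(n, r)) : normF (u - v) = normF (v - u).
Proof. by rewrite -normFN opprB. Qed.

Lemma normFZ n r a (u : 'M[R]_(n, r)) : normF (a *: u) = `|a| * normF u.
Proof. by rewrite /normF innerZl innerZr mulrA -expr2 sqrtrM ?sqr_ge0 // sqrtr_sqr. Qed.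

Lemma normF_trmx n r (u : 'M[R]_(n, r)) : normF u^T = normF u.
Proof. by rewrite /normF inner_trmx. Qed.

Lemma sqr_normFD n r (u v : 'M[R]_(n, r)) :
  normF (u + v) ^+ 2 = normF u ^+ 2 + 2 * inner u v + normF v ^+ 2.
Proof. by rewrite !sqr_normF !(innerDl, innerDr) (innerC v u); ring. Qed.

Lemma sqr_normFB n r (u v : 'M[R]_(n, r)) :
  normF (u - v) ^+ 2 = normF u ^+ 2 - 2 * inner u v + normF v ^+ 2.
Proof. by rewrite sqr_normFD innerNr normFN mulrN. Qed.

Lemma normF_CauchySchwarz n r (u v : 'M[R]_(n, r)) :
  `|inner u v| <= normF u * normF v.
Proof.
have [->|v0] := eqVneq v 0.
  by rewrite inner0r normr0 normF0 mulr0.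
have vgt0 : 0 < inner v v by rewrite lt0r inner_eq0 v0 inner_ge0.
rewrite -[leLHS]ger0_norm ?normr_ge0 // -[leRHS]ger0_norm ?mulr_ge0 ?normF_ge0 //.
rewrite -ler_sqr ?nnegrE ?normr_ge0 // !real_normK ?num_real // exprMn.
rewrite !sqr_normF.
have := inner_ge0 (inner v v *: u - inner u v *: v).
rewrite !(innerBl, innerBr, innerZl, innerZr) (innerC v u).
set x := inner u u; set y := inner v v; set z := inner u v => h.
have {h} : 0 <= y * (x * y - z ^+ 2) by rewrite expr2; apply: le_trans h _; lra.
by rewrite pmulr_rge0 // subr_ge0.
Qed.

Lemma inner_le n r (u v : 'M[R]_(n, r)) : inner u v <= normF u * normF v.
Proof. exact: le_trans (ler_norm _) (normF_CauchySchwarz u v). Qed.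

Lemma normFD n r (u v : 'M[R]_(n, r)) : normF (u + v) <= normF u + normF v.
Proof.
rewrite -ler_sqr ?nnegrE ?addr_ge0 ?normF_ge0 // sqr_normFD sqrrD.
by rewrite lerD2r lerD2l mulr_natl lerMn2r inner_le.
Qed.

Lemma normFB n r (u v : 'M[R]_(n, r)) : normF (u - v) <= normF u + normF v.
Proof. by rewrite -(normFN v) normFD. Qed.

Lemma normF_sum n r (I : Type) (s : seq I) (P : pred I) (F : I -> 'M[R]_(n, r)) :
  normF (\sum_(i <- s | P i) F i) <= \sum_(i <- s | P i) normF (F i).
Proof.
elim/big_rec2: _ => [|i x y _ h]; first by rewrite normF0.
exact: le_trans (normFD _ _) (lerD (lexx _) h).
Qed.

(** Each entry of [u *m v] is the inner product of a row of [u] and a column of [v]; Cauchy-Schwarz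
    bounds its square, and these bounds sum to the product of the squared norms. *)
Lemma normFM n p r (u : 'M[R]_(n, p)) (v : 'M[R]_(p, r)) :
  normF (u *m v) <= normF u * normF v.
Proof.
rewrite -ler_sqr ?nnegrE ?mulr_ge0 ?normF_ge0 // exprMn !sqr_normF.
have row_sqr m q (x : 'M[R]_(m, q)) : inner x x = \sum_i inner (row i x) (row i x).
  rewrite innerE; apply: eq_bigr => i _; rewrite innerE big_ord1.
  by apply: eq_bigr => j _; rewrite !mxE.
rewrite [in leRHS]row_sqr -[inner v v]inner_trmx [in leRHS]row_sqr innerE.
rewrite mulr_suml; apply: ler_sum => i _; rewrite mulr_sumr.
apply: ler_sum => j _; rewrite -expr2.
have -> : (u *m v) i j = inner (row i u) (row j v^T).
  by rewrite innerE big_ord1 mxE; apply: eq_bigr => k _; rewrite !mxE.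
rewrite -!sqr_normF -exprMn -[leLHS]real_normK ?num_real //.
by rewrite ler_sqr ?nnegrE ?mulr_ge0 ?normF_ge0 ?normF_CauchySchwarz.
Qed.

End FrobeniusNorm.


(** * Spectral theorem for real symmetric matrices *)

Section Spectral.
Variable R : realType.

(** A real symmetric matrix is Hermitian over [R[i]], hence unitarily diagonalizable with real
    spectral diagonal; the first diagonal entry descends to an eigenvalue over [R]. *)
Lemma sym_eigenvalue n (A : 'M[R]_n.+1) : A^T = A -> exists a, eigenvalue A a.
Proof.
move=> Asym.
pose f := real_complex R.
pose AC : 'M[R[i]]_n.+1 := map_mx f A.
have realf x : f x \is Num.real by rewrite complex_real.
have hAC : AC \is hermsymmx.
  apply: realsym_hermsym; last by apply/mxOverP => i j; rewrite mxE.
  apply/is_hermitianmxP; rewrite expr0 scale1r map_mx_id //.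
  by rewrite /AC map_trmx Asym.
pose P := spectralmx AC; pose D := spectral_diag AC.
have /orthomx_spectralP AE : AC \is normalmx by exact: hermitian_normalmx.
have Punit : P \in unitmx by exact: spectral_unit.
have /mxOverP/(_ 0 0) Dreal := hermitian_spectral_diag_real hAC.
have [b ab] : exists b, D 0 0 = f b.
  by exists (complex.Re (D 0 0)); rewrite -[LHS]RRe_real.
exists b; rewrite -(eigenvalue_map f) -[map_mx f A]/AC.
rewrite [X in eigenvalue _ X](_ : _ = D 0 0) //.
apply/eigenvalueP; exists (delta_mx 0 0 *m P).
  rewrite {1}AE -/P -/D !mulmxA mulmxK // scalemxAl; congr (_ *m _).
  rewrite -rowE; apply/rowP => j; rewrite !mxE eqxx (eq_sym j).
  by case: eqVneq => _; rewrite ?mulr1n ?mulr1 // mulr0n mulr0.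
apply/eqP => /(congr1 (mulmx^~ (invmx P))); rewrite mulmxK // mul0mx.
by move=> /matrixP/(_ 0 0); rewrite !mxE !eqxx => /eqP; rewrite oner_eq0.
Qed.

(** The reflection along [delta_mx 0 0 - u] exchanges the unit vectors [delta_mx 0 0] and [u]; if
    they coincide, the identity serves. *)
Lemma householder n (u : 'rV[R]_n.+1) : u *m u^T = 1%:M ->
  exists H : 'M[R]_n.+1, [/\ H^T = H, H *m H = 1%:M & delta_mx 0 0 *m H = u].
Proof.
move=> uu.
have [ue|ue] := eqVneq (delta_mx 0 0) u.
  by exists 1%:M; rewrite trmx1 !mulmx1.
pose w := delta_mx 0 0 - u.
have sB (a b : R) : (a - b)%:M = a%:M - b%:M :> 'M[R]_1 by exact: raddfB.
have e0u : delta_mx 0 0 *m u^T = (u 0 0)%:M.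
  by rewrite -rowE [LHS]mx11_scalar !mxE.
have ue0 : u *m (delta_mx 0 0)^T = (u 0 0)%:M.
  by rewrite -[LHS]trmxK trmx_mul trmxK e0u tr_scalar_mx.
have e00 : (delta_mx 0 0 : 'rV[R]_n.+1) *m (delta_mx 0 0)^T = 1%:M.
  rewrite trmx_delta mul_delta_mx.
  by apply/matrixP => i j; rewrite !ord1 !mxE.
have ew : (delta_mx 0 0 : 'rV[R]_n.+1) *m w^T = (1 - u 0 0)%:M.
  by rewrite linearB mulmxBr e00 e0u sB.
have ww : w *m w^T = (2 * (1 - u 0 0))%:M.
  rewrite {1}/w mulmxBl ew linearB mulmxBr uu ue0 -!sB.
  by congr _%:M; ring.
have c0 : 1 - u 0 0 != 0.
  apply: contra ue => /eqP c0; rewrite -subr_eq0 -/w -inner_eq0.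
  by rewrite -inner_trmx /inner trmxK ww c0 mulr0 trace_mx11 mxE mul0rn.
have hw : delta_mx 0 0 - w = u by rewrite /w opprB addrC subrK.
move: w hw ew ww => w hw ew ww.
(* The usual coefficient [2 / |w|^2] of a reflection, since [ww] says [|w|^2 = 2 * (1 - u 0 0)]. *)
exists (1%:M - (1 - u 0 0)^-1 *: (w^T *m w)); split.
- by rewrite linearB linearZ /= trmx1 trmx_mul trmxK.
- rewrite mulmxBl mul1mx -scalemxAl mulmxBr mulmx1 -scalemxAr.
  rewrite -mulmxA [in w *m _]mulmxA ww mul_scalar_mx -scalemxAr.
  rewrite scalerBr !scalerA -scalerBl -addrA -opprD -scalerDl.
  rewrite [X in X *: _](_ : _ = 0) ?scale0r ?subr0 //.
  by field; rewrite c0.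
- rewrite mulmxBr mulmx1 -scalemxAr mulmxA.
  by rewrite ew mul_scalar_mx scalerA mulVf // scale1r.
Qed.

(** Deflation: a reflection carries a unit eigenvector to the first basis vector, which makes the
    conjugate [B] block diagonal, and the induction hypothesis diagonalizes its lower block. *)
Theorem sym_spectral n (A : 'M[R]_n) : A^T = A ->
  exists (U : 'M[R]_n) (D : 'rV[R]_n), U^T *m U = 1%:M /\ A = U^T *m diag_mx D *m U.
Proof.
elim: n A => [|n IHn] A Asym.
  exists 1%:M, 0; split; first by rewrite trmx1 mulmx1.
  by apply/matrixP => -[].
have [d /eigenvalueP[v vA v0]] := sym_eigenvalue Asym.
have n0 : normF v != 0 by rewrite normF_eq0.
pose u := (normF v)^-1 *: v.
have uu : u *m u^T = 1%:M.
  rewrite [LHS]mx11_scalar -trace_mx11 mxtrace_mulC.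
  rewrite -/(inner _ _) -sqr_normF normFZ normfV ger0_norm ?normF_ge0 //.
  by rewrite mulVf // expr1n.
have uA : u *m A = d *: u by rewrite -scalemxAl vA scalerA mulrC -scalerA.
have [H [HT HH He]] := householder uu.
have uH : u *m H = delta_mx 0 0 by rewrite -He -mulmxA HH mulmx1.
pose B : 'M[R]_(1 + n) := H *m A *m H.
have BT : B^T = B by rewrite /B !trmx_mul HT Asym mulmxA.
have eB : delta_mx 0 0 *m B = d *: (delta_mx 0 0 : 'rV_n.+1).
  by rewrite /B !mulmxA He uA -scalemxAl uH.
have AE : A = H *m B *m H.
  by rewrite /B !mulmxA HH mul1mx -mulmxA HH mulmx1.
move: B BT eB AE => B BT eB AE.
have B0 j : B 0 j = d * (j == 0)%:R.
  have -> : B 0 j = row 0 B 0 j by rewrite mxE.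
  by rewrite rowE eB !mxE eqxx.
have Bul : ulsubmx B = d%:M.
  apply/matrixP => i j; rewrite !ord1 !mxE eqxx mulr1n.
  by rewrite [X in B X _](_ : _ = 0) ?B0 ?mulr1 //; apply/val_inj.
have Bur : ursubmx B = 0.
  apply/matrixP => i j; rewrite !ord1 !mxE.
  by rewrite [X in B X _](_ : _ = 0) ?B0 ?mulr0 //; apply/val_inj.
have Bdl : dlsubmx B = 0.
  by rewrite -BT -trmx_ursub Bur trmx0.
have [V [D [VV BD]]] : exists (V : 'M[R]_n) (D : 'rV[R]_n),
    V^T *m V = 1%:M /\ drsubmx B = V^T *m diag_mx D *m V.
  by apply: IHn; rewrite trmx_drsub BT.
pose K : 'M[R]_(1 + n) := block_mx 1%:M 0 0 V.
have KK : K^T *m K = 1%:M.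
  rewrite /K tr_block_mx mulmx_block !trmx1 !trmx0 !mulmx0 !mul0mx mulmx1 VV !addr0 add0r.
  by rewrite -scalar_mx_block.
have BE : B = K^T *m diag_mx (row_mx d%:M D) *m K.
  rewrite -[LHS]submxK Bul Bur Bdl BD /K tr_block_mx diag_mx_row !mulmx_block.
  rewrite !trmx1 !trmx0 !mulmx0 !mul0mx !mulmx1 !mul1mx !addr0 !add0r.
  rewrite mul0mx; congr (block_mx _ _ _ _).
  by apply/matrixP => i j; rewrite !ord1 !mxE.
exists (K *m H), (row_mx d%:M D); split.
  by rewrite trmx_mul -mulmxA (mulmxA K^T) KK mul1mx HT HH.
by rewrite [LHS]AE trmx_mul HT {1}BE !mulmxA.
Qed.
End Spectral.


(** * Positive semidefinite matrices and the polar decomposition *)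

Section PolarFactor.
Variable R : realType.
Implicit Types (n r : nat).

Lemma inner_diag r (U : 'M[R]_r) (D : 'rV[R]_r) (x : 'cV[R]_r) :
  inner x (U^T *m diag_mx D *m U *m x) = \sum_i D 0 i * (U *m x) i 0 ^+ 2.
Proof.
rewrite -!mulmxA inner_mulr trmxK innerE; apply: eq_bigr => i _.
by rewrite big_ord1 mul_diag_mx [X in _ * X]mxE; ring.
Qed.

Lemma psd_diag r (U : 'M[R]_r) (D : 'rV[R]_r) : U^T *m U = 1%:M ->
  psd (U^T *m diag_mx D *m U) <-> forall i, 0 <= D 0 i.
Proof.
move=> UU; split => [[_ h] i|h].
  (* A column of [U^T] as test vector isolates the single entry [D 0 i]. *)
  have := h (U^T *m delta_mx i 0); rewrite inner_diag.
  rewrite mulmxA (mulmx1C UU) mul1mx (bigD1 i) //= big1 ?addr0.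
    by rewrite mxE !eqxx expr1n mulr1.
  by move=> j /negPf ji; rewrite mxE ji expr0n mulr0.
split; first by rewrite !trmx_mul trmxK tr_diag_mx mulmxA.
by move=> x; rewrite inner_diag; apply: sumr_ge0 => i _; rewrite mulr_ge0 ?sqr_ge0.
Qed.

Lemma conj_diagM r (U : 'M[R]_r) (D E : 'rV[R]_r) : U^T *m U = 1%:M ->
  (U^T *m diag_mx D *m U) *m (U^T *m diag_mx E *m U) =
  U^T *m diag_mx (\row_i (D 0 i * E 0 i)) *m U.
Proof.
move=> UU; rewrite -!mulmxA; congr (_ *m _).
rewrite (mulmxA U) (mulmx1C UU) mul1mx mulmxA; congr (_ *m _).
apply/matrixP => i j; rewrite mul_diag_mx !mxE.
by case: eqVneq => [->|]; rewrite ?mulr1n // !mulr0n mulr0.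
Qed.

Lemma conj_diag1 r (U : 'M[R]_r) : U^T *m U = 1%:M ->
  U^T *m diag_mx (const_mx 1) *m U = 1%:M.
Proof. by move=> UU; rewrite diag_const_mx mulmx1. Qed.

Lemma psd_gram n r (B : 'M[R]_(n, r)) : psd (B^T *m B).
Proof.
split; first by rewrite trmx_mul trmxK.
by move=> x; rewrite -mulmxA inner_mulr trmxK inner_ge0.
Qed.

Lemma unitmx_inj r (B : 'M[R]_r) : B^T = B ->
  (forall x : 'cV[R]_r, B *m x = 0 -> x = 0) -> B \in unitmx.
Proof.
move=> Bsym Binj; rewrite -row_free_unit; apply: inj_row_free => v vB.
apply: trmx_inj; rewrite trmx0; apply: Binj.
by rewrite -{1}Bsym -trmx_mul vB trmx0.
Qed.

(** Take inverse square roots of the eigenvalues, which are nonzero because [B] is invertible. This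
    existence keeps [inv_sqrtmx] away from its default value. *)
Lemma psd_inv_sqrt r (B : 'M[R]_r) : psd B -> B \in unitmx ->
  exists2 S : 'M[R]_r, psd S & S *m S = invmx B.
Proof.
move=> Bpsd Bunit; have [U [D [UU BE]]] := sym_spectral Bpsd.1.
have D0 i : 0 <= D 0 i by move: Bpsd i; rewrite {1}BE psd_diag.
have Dn0 i : D 0 i != 0.
  apply/eqP => Di.
  have : B *m (U^T *m delta_mx i 0 : 'cV[R]_r) = 0.
    rewrite BE -!mulmxA (mulmxA U) (mulmx1C UU) mul1mx.
    rewrite (_ : diag_mx D *m _ = 0) ?mulmx0 //.
    apply/matrixP => k l; rewrite mul_diag_mx !mxE.
    by have [->|] := eqVneq k i; rewrite ?Di ?mul0r // mulr0.
  move/(congr1 (fun x => U *m (invmx B *m x))).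
  rewrite mulKmx // mulmx0 mulmx0 mulmxA (mulmx1C UU) mul1mx.
  by move/matrixP/(_ i 0); rewrite !mxE !eqxx => /eqP; rewrite oner_eq0.
pose s := \row_i (Num.sqrt (D 0 i))^-1.
exists (U^T *m diag_mx s *m U).
  by apply/(psd_diag _ UU) => i; rewrite mxE invr_ge0 sqrtr_ge0.
rewrite conj_diagM // -[RHS]mulmx1; apply: (canRL (mulKmx Bunit)).
rewrite {1}BE conj_diagM // -[RHS](conj_diag1 UU).
congr (_ *m diag_mx _ *m _); apply/rowP => i; rewrite !mxE.
by rewrite -invfM -expr2 sqr_sqrtr // mulfV.
Qed.

Lemma inv_sqrtmxP r (B : 'M[R]_r) : psd B -> B \in unitmx ->
  psd (inv_sqrtmx B) /\ inv_sqrtmx B *m inv_sqrtmx B = invmx B.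
Proof.
move=> Bpsd Bunit; have [S Spsd SS] := psd_inv_sqrt Bpsd Bunit.
by apply: (@xgetPex _ 0 [set S : 'M[R]_r | psd S /\ S *m S = invmx B]); exists S.
Qed.

(** With [S] the inverse square root of [B^T *m B], one has [B = (B S) S^-1], and [B S] has
    orthonormal columns because [B^T *m B = S^-1 S^-1]. *)
Lemma polar_decomposition n r (B : 'M[R]_(n, r)) : B^T *m B \in unitmx ->
  let Q := B *m inv_sqrtmx (B^T *m B) in
  exists T : 'M[R]_r, [/\ St Q, B = Q *m T, psd T & T *m T = B^T *m B].
Proof.
move=> Bunit Q; have [Spsd SS] := inv_sqrtmxP (psd_gram B) Bunit.
rewrite {}/Q; set S := inv_sqrtmx _ in Spsd SS *; set Q := B *m S.
have Sunit : S \in unitmx.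
  have : S *m S \in unitmx by rewrite SS unitmx_inv.
  by rewrite unitmx_mul andbb.
have BB : B^T *m B = invmx S *m invmx S.
  apply: (can_inj (mulKmx Sunit)); apply: (can_inj (mulKmx Sunit)).
  rewrite mulKVmx // mulmxV // mulmxA SS mulVmx //.
have [ST Spos] := Spsd.
exists (invmx S); split.
- by rewrite /St /= trmx_mul ST -mulmxA (mulmxA _ B) BB !mulmxA mulmxV // mul1mx mulVmx.
- by rewrite /Q mulmxK.
- split; first by rewrite trmx_inv ST.
  by move=> x; have := Spos (invmx S *m x); rewrite mulKVmx // innerC.
- by rewrite BB.
Qed.

(** In an eigenbasis of [T] this is the scalar fact that [d >= 0] and [d ^+ 2 >= 1] give
    [d >= 1]. *)
Lemma psd_sub1 r (T : 'M[R]_r) : psd T -> psd (T *m T - 1%:M) -> psd (T - 1%:M).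
Proof.
move=> Tpsd TTpsd; have [U [D [UU TE]]] := sym_spectral Tpsd.1.
have D0 i : 0 <= D 0 i by move: Tpsd i; rewrite {1}TE psd_diag.
have sub1 (a : 'rV[R]_r) : U^T *m diag_mx a *m U - 1%:M =
    U^T *m diag_mx (a - const_mx 1) *m U.
  by rewrite raddfB /= mulmxBr mulmxBl conj_diag1.
have D1 i : 1 <= D 0 i.
  move: TTpsd; rewrite TE conj_diagM // sub1 => /(psd_diag _ UU)/(_ i).
  by rewrite !mxE subr_ge0 -expr2 -{1}(expr1n _ 2) ler_sqr // nnegrE.
by rewrite TE sub1; apply/(psd_diag _ UU) => i; rewrite !mxE subr_ge0.
Qed.

(** The value is the trace of [E T E^T], a sum of values of the quadratic form of [T] at the rows of
    [E]. *)
Lemma inner_psd_ge0 n r (T : 'M[R]_r) (E : 'M[R]_(n, r)) : psd T ->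
  0 <= inner E (E *m T).
Proof.
move=> [Tsym Tpos].
have colM (u v : 'M[R]_(r, n)) : inner u v = \sum_j inner (col j u) (col j v).
  rewrite innerE exchange_big; apply: eq_bigr => j _; rewrite innerE.
  by apply: eq_bigr => i _; rewrite big_ord1 !mxE.
rewrite -inner_trmx trmx_mul Tsym colM; apply: sumr_ge0 => j _.
by rewrite !colE -mulmxA Tpos.
Qed.
End PolarFactor.


(** * Tangent projection and polar retraction on the Stiefel manifold *)

Section Stiefel.
Variables (R : realType) (n r : nat).
Implicit Types X Y Z u v : 'M[R]_(n, r).

Lemma normF_St X : St X -> normF X ^+ 2 = r%:R.
Proof. by move=> XX; rewrite sqr_normF /inner XX mxtrace1. Qed.

Lemma addf_halves : 2^-1 + 2^-1 = 1 :> R.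
Proof. by field. Qed.

Lemma trmxD m p (u v : 'M[R]_(m, p)) : (u + v)^T = u^T + v^T.
Proof. exact: raddfD. Qed.

Lemma trmxB m p (u v : 'M[R]_(m, p)) : (u - v)^T = u^T - v^T.
Proof. exact: raddfB. Qed.

Lemma trmxZ m p a (u : 'M[R]_(m, p)) : (a *: u)^T = a *: u^T.
Proof. exact: linearZ. Qed.

Lemma tangentD X u v : tangent X u -> tangent X v -> tangent X (u + v).
Proof.
move=> hu hv; rewrite /tangent /= trmxD mulmxDr mulmxDl addrACA.
by rewrite [X in X + _]hu [X in _ + X]hv addr0.
Qed.

Lemma tangentZ X a u : tangent X u -> tangent X (a *: u).
Proof.
by move=> hu; rewrite /tangent /= trmxZ -scalemxAr -scalemxAl -scalerDr hu scaler0.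
Qed.

Lemma tangent_projT X Y : St X -> tangent X (projT X Y).
Proof.
move=> XX; rewrite /tangent /projT /=.
set S := X^T *m Y + Y^T *m X.
have ST : S^T = S by rewrite /S trmxD !trmx_mul !trmxK addrC.
rewrite trmxB trmxZ mulmxBr mulmxBl trmx_mul ST.
rewrite -scalemxAr -scalemxAl mulmxA XX mul1mx -mulmxA XX mulmx1 addrACA -opprD.
by rewrite -scalerDl addf_halves scale1r /S subrr.
Qed.

(** [X^T *m u] is skew-symmetric, hence orthogonal to every symmetric [S]: the matrices [X *m S] are
    normal at [X]. *)
Lemma tangent_inner_sym X u (S : 'M[R]_r) : tangent X u -> S^T = S ->
  inner u (X *m S) = 0.
Proof.
move=> hu ST; apply/eqP; rewrite -[_ == 0](mulrn_eq0 _ 2) mulr2n.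
rewrite {1}/inner -mxtrace_tr !trmx_mul trmxK ST -mulmxA mxtrace_mulC.
rewrite /inner (mulmxA u^T) -mxtraceD -mulmxDl.
by move: hu; rewrite /tangent /= => ->; rewrite mul0mx mxtrace0.
Qed.

Lemma projT_residual X Y :
  exists2 S : 'M[R]_r, S^T = S & Y = projT X Y + X *m S.
Proof.
exists (2^-1 *: (X^T *m Y + Y^T *m X)); last by rewrite -scalemxAr subrK.
by rewrite trmxZ trmxD !trmx_mul !trmxK addrC.
Qed.

Lemma inner_projT X Y : St X -> inner (projT X Y) Y = normF (projT X Y) ^+ 2.
Proof.
move=> XX; have [S ST YE] := projT_residual X Y.
by rewrite {2}YE innerDr (tangent_inner_sym (tangent_projT Y XX)) // addr0 sqr_normF.
Qed.

Lemma normF_projT X Y : St X -> normF (projT X Y) <= normF Y.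
Proof.
move=> XX; have := inner_le (projT X Y) Y; rewrite inner_projT // expr2.
have := normF_ge0 (projT X Y); rewrite le_eqVlt => /orP[/eqP <- _|p0].
  exact: normF_ge0.
by rewrite ler_pM2l.
Qed.

Lemma projTB X Y Z : projT X (Y - Z) = projT X Y - projT X Z.
Proof.
have E : X^T *m (Y - Z) + (Y - Z)^T *m X =
    (X^T *m Y + Y^T *m X) - (X^T *m Z + Z^T *m X).
  by rewrite trmxB mulmxBr mulmxBl addrACA -opprD.
rewrite /projT E mulmxBr scalerBr !opprB addrACA [RHS]addrACA.
by congr (_ + _); rewrite addrC.
Qed.

Lemma projT_id X : St X -> projT X X = 0.
Proof.
move=> XX; rewrite /projT XX mulmxDr mulmx1 scalerDr -scalerDl addf_halves.
by rewrite scale1r subrr.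
Qed.

(** Tangency cancels the cross terms; thus [polar_retr X v] is the orthonormal polar factor of
    [X + v]. *)
Lemma gram_tangent X v : St X -> tangent X v ->
  (X + v)^T *m (X + v) = 1%:M + v^T *m v.
Proof.
move=> XX hv; rewrite trmxD mulmxDr !mulmxDl XX addrA; congr (_ + _).
by rewrite -addrA [X in _ + X]addrC [X in _ + X]hv addr0.
Qed.

Lemma unit_add1_gram v : 1%:M + v^T *m v \in unitmx.
Proof.
apply: unitmx_inj => [|x].
  by rewrite trmxD trmx1 trmx_mul trmxK.
rewrite mulmxDl mul1mx => /(congr1 (inner x)).
rewrite innerDr inner0r -mulmxA inner_mulr trmxK => /eqP.
by rewrite paddr_eq0 ?inner_ge0 // inner_eq0 => /andP[/eqP].
Qed.

Lemma polar_retr_St X v : St X -> tangent X v -> St (polar_retr X v).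
Proof.
move=> XX hv; rewrite /polar_retr -(gram_tangent XX hv).
have [|T [] //] := @polar_decomposition _ _ _ (X + v).
by rewrite gram_tangent // unit_add1_gram.
Qed.

(** Both [inner X (X *m S)] and [inner Y (Y *m S)] equal the trace of [S], and the mixed terms agree
    by symmetry of [S]. For [S = 1] this is the polarization identity for vectors of equal
    length. *)
Lemma inner_St_sub X Y (S : 'M[R]_r) : St X -> St Y -> S^T = S ->
  inner (X - Y) (X *m S) = 2^-1 * inner (X - Y) ((X - Y) *m S).
Proof.
move=> XX YY ST; rewrite mulmxBl !(innerBl, innerBr).
have -> : inner X (Y *m S) = inner Y (X *m S).
  by rewrite /inner -[LHS]mxtrace_tr !trmx_mul trmxK ST -mulmxA mxtrace_mulC mulmxA.
by rewrite /inner !mulmxA XX YY; lra.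
Qed.

(* With [B = X + v = Q T] its polar decomposition,
   [|B - Z|^2 - |Q - Z|^2 = |T - 1|^2 + tr ((Q - Z) (T - 1) (Q - Z)^T)], and
   [T - 1] is positive semidefinite because [T^2 = 1 + v^T v]. *)
Lemma polar_retr_nonexpansive X v Z : St X -> tangent X v -> St Z ->
  normF (polar_retr X v - Z) <= normF (X + v - Z).
Proof.
move=> XX hv ZZ; rewrite /polar_retr -(gram_tangent XX hv).
have [|T [QQ BE Tpsd TT]] := @polar_decomposition _ _ _ (X + v).
  by rewrite gram_tangent // unit_add1_gram.
set Q := _ *m inv_sqrtmx _ in QQ BE *.
rewrite BE; have T1 : psd (T - 1%:M).
  by apply: psd_sub1 => //; rewrite TT gram_tangent // addrC addKr; exact: psd_gram.
have h := inner_psd_ge0 (Q - Z) T1.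
have h1 : inner (Q - Z) (Q *m (T - 1%:M)) = 2^-1 * inner (Q - Z) ((Q - Z) *m (T - 1%:M)).
  by apply: inner_St_sub => //; exact: T1.1.
rewrite -ler_sqr ?nnegrE ?normF_ge0 //.
have -> : Q *m T - Z = (Q - Z) + Q *m (T - 1%:M).
  by rewrite mulmxBr mulmx1 [RHS]addrC [RHS]addrA subrK.
rewrite [leRHS]sqr_normFD h1; have := sqr_ge0 (normF (Q *m (T - 1%:M))); lra.
Qed.

End Stiefel.


(** * A Jensen inequality and the induced arithmetic mean *)

Lemma jensen_sqr (R : realFieldType) (I : Type) (s : seq I) (w a : I -> R) :
  (forall i, 0 <= w i) -> \sum_(i <- s) w i <= 1 ->
  (\sum_(i <- s) w i * a i) ^+ 2 <= \sum_(i <- s) w i * a i ^+ 2.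
Proof.
move=> w0 w1; set m := \sum_(i <- s) w i * a i.
(* The weighted second moment about [m] is nonnegative; as the weights sum to at most 1, its last
   term is bounded by [m ^+ 2]. *)
have : 0 <= \sum_(i <- s) w i * (a i - m) ^+ 2.
  by apply: sumr_ge0 => i _; rewrite mulr_ge0 ?sqr_ge0.
have -> : \sum_(i <- s) w i * (a i - m) ^+ 2 =
    \sum_(i <- s) w i * a i ^+ 2 - 2 * m * m + m ^+ 2 * \sum_(i <- s) w i.
  transitivity (\sum_(i <- s) (w i * a i ^+ 2 + - (2 * m) * (w i * a i) + m ^+ 2 * w i)).
    by apply: eq_bigr => i _; ring.
  by rewrite !big_split /= -!mulr_sumr -/m mulNr.
have : m ^+ 2 * \sum_(i <- s) w i <= m ^+ 2 by rewrite ler_piMr ?sqr_ge0.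
lra.
Qed.

Section ArithmeticMean.
Variables (R : realType) (n r N : nat).
Hypothesis N_gt0 : (0 < N)%N.
Implicit Types (X : 'I_N -> 'M[R]_(n, r)) (Y Z Xh : 'M[R]_(n, r)) (s : R).

Definition amean X : 'M[R]_(n, r) := N%:R^-1 *: \sum_i X i.

Let N0 : 0 < N%:R :> R. Proof. by rewrite ltr0n. Qed.
Let Nn0 : N%:R != 0 :> R. Proof. by rewrite gt_eqF. Qed.

Lemma amean_const Z : amean (fun=> Z) = Z.
Proof. by rewrite /amean sumr_const card_ord -[Z *+ N]scaler_nat scalerA mulVf // scale1r. Qed.

Lemma ameanB X1 X2 : amean X1 - amean X2 = amean (fun i => X1 i - X2 i).
Proof. by rewrite /amean -scalerBr sumrB. Qed.

Lemma normF_amean X : normF (amean X) <= N%:R^-1 * \sum_i normF (X i).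
Proof.
rewrite normFZ ger0_norm ?invr_ge0 ?ler0n //.
by rewrite ler_pM2l ?invr_gt0 // normF_sum.
Qed.

Lemma sqr_normF_amean X : normF (amean X) ^+ 2 <= N%:R^-1 * \sum_i normF (X i) ^+ 2.
Proof.
apply: (@le_trans _ _ ((\sum_i N%:R^-1 * normF (X i)) ^+ 2)).
  rewrite ler_sqr ?nnegrE ?normF_ge0 -?mulr_sumr ?normF_amean //.
  by rewrite mulr_ge0 ?invr_ge0 ?ler0n // sumr_ge0 // => i _; exact: normF_ge0.
rewrite [leRHS]mulr_sumr; apply: jensen_sqr => [i|].
  by rewrite invr_ge0 ler0n.
by rewrite sumr_const card_ord -[_ *+ N]mulr_natl mulfV.
Qed.

(** Stiefel points have constant norm, so the least-squares objective is affine in [Y], and an IAM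
    is a maximizer of the linear form [inner Y (amean X)]. *)
Lemma sum_sqr_dist X Y : (forall i, St (X i)) -> St Y ->
  \sum_i normF (Y - X i) ^+ 2 = 2 * N%:R * (r%:R - inner Y (amean X)).
Proof.
move=> XS YS; rewrite /amean innerZr inner_sumr.
transitivity (\sum_(i < N) (2 * r%:R - 2 * inner Y (X i))).
  by apply: eq_bigr => i _; rewrite sqr_normFB !normF_St //; ring.
rewrite sumrB sumr_const card_ord -mulr_sumr -[(2 * r%:R) *+ N]mulr_natl.
by field.
Qed.

Lemma iamP X Xh : (forall i, St (X i)) ->
  is_iam X Xh <-> St Xh /\ forall Y, St Y -> inner Y (amean X) <= inner Xh (amean X).
Proof.
move=> XS; split=> -[XhS h]; split=> // Y YS; move: (h Y YS);
  rewrite !sum_sqr_dist // ler_pM2l ?mulr_gt0 ?ltr0n // lerD2l lerN2 //.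
Qed.

(** Retracting [t *: u] from [Xh] raises the linear objective by [t * c] up to an error of at most
    [t ^+ 2 * c * (M * normF m)]; maximality forces [c = 0]. *)
Lemma iam_stationary (M : R) X Xh : 0 < M -> @second_order_retr R n r M ->
  (forall i, St (X i)) -> is_iam X Xh -> projT Xh (amean X) = 0.
Proof.
move=> M0 hM XS /iamP - /(_ XS) [XhS Xhmax].
set m := amean X in Xhmax *; set u := projT Xh m.
apply/eqP; rewrite -inner_eq0 -sqr_normF.
set c := normF u ^+ 2; have [//|c0] := eqVneq c 0.
have {}c0 : 0 < c by rewrite lt0r c0 sqr_ge0.
have Mm : 0 < M * normF m + 1 by rewrite ltr_wpDl ?mulr_ge0 ?normF_ge0 ?ltW.
(* Small enough for [t * (M * normF m) < 1], so that the first-order gain exceeds the error. *)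
pose t := (M * normF m + 1)^-1; have t0 : 0 < t by rewrite invr_gt0.
have tu : tangent Xh (t *: u) by apply/tangentZ/tangent_projT.
have := Xhmax _ (polar_retr_St XhS tu).
have := hM _ _ XhS tu; set e := _ - _ => he.
rewrite -[polar_retr _ _](subrK (Xh + t *: u)) -/e.
move: e he => e he; rewrite !innerDl innerZl inner_projT // -/u -/c.
have : - (t ^+ 2 * c * (M * normF m)) <= inner e m.
  rewrite lerNl -innerNl; apply: le_trans (inner_le _ _) _.
  rewrite normFN; apply: le_trans (ler_wpM2r (normF_ge0 m) he) _.
  by rewrite normFZ exprMn real_normK ?num_real // -/c; lra.
have : t * c * (t * (M * normF m)) < t * c.
  have tM : t * (M * normF m) < 1 by rewrite ltr_pdivrMl // mulr1; lra.
  by rewrite gtr_pMr // mulr_gt0.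
lra.
Qed.

(** For Stiefel points this is [2 - (Xh^T m + m^T Xh)] with [m] the Euclidean mean. *)
Definition gram_dev X Xh : 'M[R]_r :=
  N%:R^-1 *: \sum_i (X i - Xh)^T *m (X i - Xh).

Lemma gram_dev_sym X Xh : (gram_dev X Xh)^T = gram_dev X Xh.
Proof.
rewrite trmxZ raddf_sum; congr (_ *: _); apply: eq_bigr => i _ /=.
by rewrite trmx_mul trmxK.
Qed.

Lemma normF_gram n1 r1 (D : 'M[R]_(n1, r1)) : normF (D^T *m D) <= normF D ^+ 2.
Proof. by apply: le_trans (normFM _ _) _; rewrite normF_trmx. Qed.

Lemma normF_gram_dev X Xh s : \sum_i normF (X i - Xh) ^+ 2 <= N%:R * s ->
  normF (gram_dev X Xh) <= s.
Proof.
move=> h; rewrite normFZ ger0_norm ?invr_ge0 ?ler0n // mulrC ler_pdivrMr //.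
rewrite mulrC; apply: le_trans h; apply: le_trans (normF_sum _ _ _) _.
by apply: ler_sum => i _; exact: normF_gram.
Qed.

Lemma gram_St_sub Y Z : St Y -> St Z ->
  (Y - Z)^T *m (Y - Z) = 2%:M - (Z^T *m Y + Y^T *m Z).
Proof.
move=> YS ZS; rewrite trmxB mulmxBr !mulmxBl [Y^T *m Y]YS [Z^T *m Z]ZS opprB.
by rewrite addrACA -opprD -raddfD.
Qed.

(** A vanishing projection means [m = Xh *m S] with [S] the symmetric part of [Xh^T *m m]; expanding
    the Gram matrices of the deviations identifies [S]. *)
Lemma iam_factor (M : R) X Xh : 0 < M -> @second_order_retr R n r M ->
  (forall i, St (X i)) -> is_iam X Xh ->
  amean X = Xh *m (1%:M - 2^-1 *: gram_dev X Xh).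
Proof.
move=> M0 hM XS hXh; have XhS : St Xh by case: hXh.
have /eqP := iam_stationary M0 hM XS hXh; rewrite subr_eq0 => /eqP ->.
rewrite scalemxAr; congr (_ *m _).
have -> : gram_dev X Xh = 2%:M - (Xh^T *m amean X + (amean X)^T *m Xh).
  rewrite /gram_dev (eq_bigr _ (fun i _ => gram_St_sub (XS i) XhS)) sumrB sumr_const card_ord.
  rewrite scalerBr -[2%:M *+ N]scaler_nat scalerA mulVf // scale1r; congr (_ - _).
  rewrite /amean trmxZ -scalemxAr -scalemxAl -scalerDr; congr (_ *: _).
  by rewrite big_split /= -mulmx_sumr -mulmx_suml -raddf_sum.
rewrite [in RHS]scalerBr scale_scalar_mx mulVf ?pnatr_eq0 //.
by rewrite opprB [RHS]addrC subrK.
Qed.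

Lemma iam_amean_dist (M s : R) X Xh : 0 < M -> @second_order_retr R n r M ->
  (forall i, St (X i)) -> is_iam X Xh -> \sum_i normF (X i - Xh) ^+ 2 <= N%:R * s ->
  normF (amean X - Xh) <= s / 2.
Proof.
move=> M0 hM XS hXh /normF_gram_dev hs; have XhS : St Xh by case: hXh.
rewrite (iam_factor M0 hM XS hXh) mulmxBr mulmx1 addrC addKr normFN.
have -> : normF (Xh *m (2^-1 *: gram_dev X Xh)) = normF (2^-1 *: gram_dev X Xh).
  by rewrite /normF inner_mull mulmxA XhS mul1mx.
by rewrite normFZ ger0_norm ?invr_ge0 // mulrC ler_pM2r ?invr_gt0.
Qed.

(** Quadratic growth at the maximizer: by [iam_factor] and [inner_St_sub] the gap is half the form
    of [1 - gram_dev / 2] at [Xh - Y], and [gram_dev] has norm at most [s]. *)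
Lemma iam_gap (M s : R) X Xh Y : 0 < M -> @second_order_retr R n r M ->
  (forall i, St (X i)) -> is_iam X Xh -> \sum_i normF (X i - Xh) ^+ 2 <= N%:R * s ->
  St Y ->
  2^-1 * (1 - s / 2) * normF (Xh - Y) ^+ 2 <= inner (Xh - Y) (amean X).
Proof.
move=> M0 hM XS hXh /normF_gram_dev hs YS; have XhS : St Xh by case: hXh.
rewrite (iam_factor M0 hM XS hXh) inner_St_sub //; last first.
  by rewrite trmxB trmxZ trmx1 gram_dev_sym.
set E := Xh - Y; rewrite mulmxBr mulmx1 innerBr -scalemxAr innerZr -sqr_normF.
have : inner E (E *m gram_dev X Xh) <= normF E ^+ 2 * s.
  rewrite inner_mulr; apply: le_trans (inner_le _ _) _.
  by rewrite ler_pM ?normF_ge0 ?normF_gram.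
lra.
Qed.

(** The growth bounds at the two maximizers, each tested at the other one, add up to a strong
    monotonicity inequality, which Cauchy-Schwarz turns into the estimate. *)
Lemma iam_lipschitz (M s : R) X1 X2 Xh1 Xh2 : 0 < M -> @second_order_retr R n r M ->
  (forall i, St (X1 i)) -> (forall i, St (X2 i)) -> is_iam X1 Xh1 -> is_iam X2 Xh2 ->
  \sum_i normF (X1 i - Xh1) ^+ 2 <= N%:R * s ->
  \sum_i normF (X2 i - Xh2) ^+ 2 <= N%:R * s ->
  (1 - s / 2) * normF (Xh1 - Xh2) <= normF (amean X1 - amean X2).
Proof.
move=> M0 hM S1 S2 h1 h2 d1 d2.
have g1 := iam_gap M0 hM S1 h1 d1 h2.1.
have := iam_gap M0 hM S2 h2 d2 h1.1; rewrite normF_distC -[Xh2 - Xh1]opprB innerNl => g2.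
have := inner_le (Xh1 - Xh2) (amean X1 - amean X2); rewrite innerBr.
have := normF_ge0 (Xh1 - Xh2); rewrite le_eqVlt => /orP[/eqP <- _|p0 h].
  by rewrite mulr0 normF_ge0.
by rewrite -(ler_pM2l p0); lra.
Qed.

(** The polar factor of the Euclidean mean maximizes the linear objective. It is available because
    the mean is at distance below 1 from [Z] and so has full column rank. *)
Lemma iam_exists (s : R) X Z : (forall i, St (X i)) -> St Z ->
  \sum_i normF (X i - Z) ^+ 2 <= N%:R * s -> s < 1 -> exists Xh, is_iam X Xh.
Proof.
move=> XS ZS hs s1; set m := amean X.
have hm : normF (m - Z) ^+ 2 < 1.
  rewrite -(amean_const Z) ameanB; apply: le_lt_trans (sqr_normF_amean _) _.
  by rewrite mulrC ltr_pdivrMr // mul1r; apply: le_lt_trans hs _; rewrite gtr_pMr.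
have munit : m^T *m m \in unitmx.
  apply: unitmx_inj => [|x]; first by rewrite trmx_mul trmxK.
  move/(congr1 (inner x)); rewrite inner0r -mulmxA inner_mulr trmxK => /eqP.
  rewrite inner_eq0 => /eqP mx0; apply/eqP; rewrite -normF_eq0; apply/negPn/negP => x0.
  have {}x0 : 0 < normF x by rewrite lt0r x0 normF_ge0.
  (* As [m *m x = 0] and [Z] is an isometry, [|x| = |(m - Z) x|]. *)
  have : normF x <= normF (m - Z) * normF x.
    apply: le_trans (normFM _ _); rewrite mulmxBl mx0 sub0r normFN.
    by rewrite /normF inner_mull mulmxA ZS mul1mx.
  have n1 : normF (m - Z) < 1 by rewrite -ltr_sqr ?nnegrE ?normF_ge0 // expr1n.
  by rewrite -{1}[normF x]mul1r ler_pM2r // leNgt n1.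
have [T [QS mE Tpsd _]] := polar_decomposition munit.
exists (m *m inv_sqrtmx (m^T *m m)); apply/iamP => //; split => // Y YS.
set Q := _ *m inv_sqrtmx _ in QS mE *; rewrite -/m mE -subr_ge0 -innerBl.
by rewrite inner_St_sub ?Tpsd.1 // mulr_ge0 ?invr_ge0 ?inner_psd_ge0.
Qed.
End ArithmeticMean.


(** * Spectral gap and mixing bounds for the weight matrix *)

Lemma char_poly_spectral (R : realType) n (U : 'M[R]_n) (D : 'rV[R]_n) :
  U^T *m U = 1%:M ->
  char_poly (U^T *m diag_mx D *m U) = \prod_i ('X - (D 0 i)%:P).
Proof.
move=> UU; pose V := map_mx (@polyC R) U.
have VV : V^T *m V = 1%:M by rewrite /V map_trmx -map_mxM UU map_mx1.
have dV : \det V^T * \det V = 1 by rewrite -det_mulmx VV det1.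
transitivity (char_poly (diag_mx D)); last first.
  rewrite char_poly_trig ?diag_mx_is_trig //.
  by apply: eq_bigr => i _; rewrite mxE eqxx mulr1n.
rewrite /char_poly /char_poly_mx !map_mxM /= -map_trmx -/V.
rewrite -[RHS]mulr1 -dV mulrCA mulrA -!det_mulmx -mulmxA; congr (\det _).
by rewrite mulmxBr mulmxBl mul_mx_scalar -scalemxAl VV scalemx1 !mulmxA.
Qed.

Section Mixing.
Variables (R : realType) (N : nat) (e : rel 'I_N) (W : 'M[R]_N).
Hypotheses (N_gt1 : (1 < N)%N) (he : connected_graph e) (hW : weight_matrix e W).
Implicit Types (x y : 'cV[R]_N).

Local Notation one := (const_mx 1 : 'cV[R]_N).

Let WT : W^T = W. Proof. by case: hW. Qed.
Let W1 : W *m one = one. Proof. by case: hW. Qed.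

Let N0 : 0 < N%:R :> R. Proof. by rewrite ltr0n (ltn_trans _ N_gt1). Qed.

Lemma weight_ge0 i j : 0 <= W i j.
Proof.
case: hW => Wpos W0 _ _; have [/Wpos/ltW //|/W0 ->] := boolP (e i j || (i == j)).
exact: lexx.
Qed.

Lemma weight_pow_ge0 t i j : 0 <= (W ^+ t) i j.
Proof.
elim: t i j => [|t IHt] i j; first by rewrite expr0 mxE ler0n.
by rewrite exprS mxE; apply: sumr_ge0 => k _; rewrite mulr_ge0 ?weight_ge0.
Qed.

Lemma weight_pow_sym t : (W ^+ t)^T = W ^+ t.
Proof.
elim: t => [|t IHt]; first by rewrite expr0 trmx1.
by rewrite {1}exprS exprSr -[W * _]/(W *m _) trmx_mul IHt WT.
Qed.

Lemma weight_pow_one t : W ^+ t *m one = one.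
Proof.
elim: t => [|t IHt]; first by rewrite expr0 mul1mx.
by rewrite exprSr -[_ * W]/(_ *m W) -mulmxA W1.
Qed.

Lemma weight_pow_row_sum t i : \sum_j (W ^+ t) i j = 1.
Proof.
have /matrixP/(_ i 0) := weight_pow_one t; rewrite !mxE => <-.
by apply: eq_bigr => j _; rewrite mxE mulr1.
Qed.

Lemma weight_pow_symE t i j : (W ^+ t) i j = (W ^+ t) j i.
Proof. by rewrite -{1}weight_pow_sym mxE. Qed.

Lemma weight_pow_col_sum t j : \sum_i (W ^+ t) i j = 1.
Proof.
by rewrite -(weight_pow_row_sum t j); apply: eq_bigr => i _; rewrite weight_pow_symE.
Qed.

Lemma inner_cV x y : inner x y = \sum_i x i 0 * y i 0.
Proof. by rewrite innerE; apply: eq_bigr => i _; rewrite big_ord1. Qed.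

Let B := W ^+ 2.

Lemma sqr_normF_weight x : normF (W *m x) ^+ 2 = inner x (B *m x).
Proof. by rewrite sqr_normF /B expr2 -mulmxA [RHS]inner_mulr WT. Qed.

(** Rows and columns of [B] sum to 1, so each family of diagonal terms in the expanded squares gives
    [inner x x]. The left side is the loss of squared norm under [W]. *)
Lemma weight_dirichlet x :
  inner x x - inner x (B *m x) = 2^-1 * \sum_i \sum_j B i j * (x i 0 - x j 0) ^+ 2.
Proof.
have -> : \sum_i \sum_j B i j * (x i 0 - x j 0) ^+ 2 =
   \sum_i \sum_j B i j * x i 0 ^+ 2 + \sum_i \sum_j B i j * x j 0 ^+ 2
   - 2 * \sum_i \sum_j x i 0 * (B i j * x j 0).
  rewrite mulr_sumr -sumrN -!big_split /=; apply: eq_bigr => i _.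
  rewrite mulr_sumr -sumrN -!big_split /=; apply: eq_bigr => j _; ring.
have -> : \sum_i \sum_j B i j * x i 0 ^+ 2 = inner x x.
  rewrite inner_cV; apply: eq_bigr => i _.
  by rewrite -mulr_suml weight_pow_row_sum mul1r expr2.
have -> : \sum_i \sum_j B i j * x j 0 ^+ 2 = inner x x.
  rewrite exchange_big inner_cV; apply: eq_bigr => i _.
  by rewrite -mulr_suml weight_pow_col_sum mul1r expr2.
have -> : \sum_i \sum_j x i 0 * (B i j * x j 0) = inner x (B *m x).
  by rewrite inner_cV; apply: eq_bigr => i _; rewrite mxE mulr_sumr.
by lra.
Qed.

(* The Dirichlet form of [x] vanishes, so [x] is constant along the edges of
   [W ^+ 2], which include those of the graph since the diagonal of [W] is positive. *)
Lemma normF_weight_strict x : inner one x = 0 -> normF x <= normF (W *m x) -> x = 0.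
Proof.
move=> x1 hx; have [Wpos _ _ _] := hW; have [_ econ] := he.
have ge0 i j : 0 <= B i j * (x i 0 - x j 0) ^+ 2.
  by rewrite mulr_ge0 ?sqr_ge0 ?weight_pow_ge0.
have sum0 : \sum_i \sum_j B i j * (x i 0 - x j 0) ^+ 2 = 0.
  apply/eqP; rewrite eq_le; apply/andP; split; last first.
    by do 2!apply: sumr_ge0 => ? _.
  rewrite -(pmulr_rle0 _ (_ : 0 < 2^-1)) ?invr_gt0 // -weight_dirichlet.
  by rewrite subr_le0 -sqr_normF_weight -sqr_normF ler_sqr ?nnegrE ?normF_ge0.
have term0 i j : B i j * (x i 0 - x j 0) ^+ 2 = 0.
  have h0 k : true -> 0 <= \sum_j B k j * (x k 0 - x j 0) ^+ 2.
    by move=> _; apply: sumr_ge0.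
  have /(_ i isT) si := psumr_eq0P h0 sum0.
  by have /(_ j isT) := psumr_eq0P (fun j _ => ge0 i j) si.
have edge i j : e i j -> x i 0 = x j 0.
  move=> eij; have /eqP := term0 i j; rewrite mulf_eq0 sqrf_eq0 subr_eq0.
  case/orP => [|/eqP //]; rewrite gt_eqF // /B expr2 mxE (bigD1 i) //=.
  rewrite ltr_wpDr ?mulr_gt0 ?Wpos ?eqxx ?orbT ?eij //.
  by apply: sumr_ge0 => k _; rewrite mulr_ge0 ?weight_ge0.
have const i j : x i 0 = x j 0.
  have /connectP[p] := econ i j; elim: p i => [|k p IHp] i /= => [_ -> //|].
  by move=> /andP[/edge -> /IHp h] /h.
have i0 := Ordinal (ltn_trans (ltnSn 0) N_gt1).
have : x i0 0 *+ N = 0.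
  transitivity (\sum_(i < N) x i0 0); first by rewrite sumr_const card_ord.
  rewrite -[RHS]x1 inner_cV; apply: eq_bigr => i _.
  by rewrite mxE mul1r (const i0 i).
move/eqP; rewrite -mulr_natr mulf_eq0 (gt_eqF N0) orbF => /eqP xi0.
by apply/matrixP => i j; rewrite ord1 mxE (const i i0).
Qed.

(** The eigenvalues of [W ^+ 2] are the squared singular values. In the sorted list only the first
    can exceed [sigma ^+ 2], and the first two are at least [sigma ^+ 2]; the list is then replaced
    by these two counts. *)
Lemma second_singular_value_spectral (sigma : R) : second_singular_value W sigma ->
  0 <= sigma /\ exists (U : 'M[R]_N) (D : 'rV[R]_N),
  [/\ U^T *m U = 1%:M, B = U^T *m diag_mx D *m U,
      forall i j, sigma ^+ 2 < D 0 i -> sigma ^+ 2 < D 0 j -> i = j &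
      exists i j, [/\ i != j, sigma ^+ 2 <= D 0 i & sigma ^+ 2 <= D 0 j]].
Proof.
move=> [s [s_sorted s_ge0 sE] ->].
have [U [D [UU BE]]] := sym_spectral (weight_pow_sym 2).
have Dperm : perm_eq [seq D 0 i | i <- index_enum 'I_N] [seq a ^+ 2 | a <- s].
  apply: prod_XsubC_eq; rewrite !big_map -sE -(char_poly_spectral _ UU).
  by rewrite -BE WT expr2.
have card_count (p : pred R) : #|[pred i | p (D 0 i)]| = count p [seq a ^+ 2 | a <- s].
  by rewrite -(permP Dperm) -sum1_count big_map -sum1_card; apply: eq_bigl.
have : size s = N.
  rewrite -(size_map (fun a : R => a ^+ 2)) -(perm_size Dperm) size_map -sum1_size.
  by rewrite -[RHS](card_ord N) -sum1_card; apply: eq_bigl.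
case: s s_sorted s_ge0 {sE Dperm} card_count => [|s0 [|s1 s]] /=.
(* With fewer than two singular values the entry of index 1 would be a default; [N_gt1] excludes
   this. *)
- by move=> _ _ _ sN; have := N_gt1; rewrite -[X in (_ < X)%N]sN.
- by move=> _ _ _ sN; have := N_gt1; rewrite -[X in (_ < X)%N]sN.
move=> /andP[s10 s1s] /and3P[s0_ge0 s1_ge0 s_ge0] cardE _.
split=> //; exists U, D; split=> //.
  suff /card_le1_eqP h : (#|[pred i | (s1 ^+ 2 < D 0 i)%R]| <= 1)%N by move=> i j hi hj; apply: h.
  rewrite (cardE (fun d => s1 ^+ 2 < d)) ltxx add0n.
  rewrite (_ : count _ _ = 0)%N ?addn0 ?leq_b1 //.
  apply/eqP; rewrite -leqn0 leqNgt -has_count; apply/hasPn => _ /mapP[x xs ->].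
  have xs1 : x <= s1.
    by move: s1s; rewrite (path_sortedE (rev_trans le_trans)) => /andP[/allP/(_ _ xs)].
  by rewrite -leNgt ler_sqr ?nnegrE // (allP s_ge0).
suff /card_gt1P[i [j [hi hj ij]]] : (1 < #|[pred i | (s1 ^+ 2 <= D 0 i)%R]|)%N by exists i, j.
by rewrite (cardE (fun d => s1 ^+ 2 <= d)) lexx ler_sqr ?nnegrE // s10.
Qed.

(** Otherwise two orthonormal eigenvectors of [W ^+ 2] have eigenvalue at least 1, and a nonzero
    combination of them orthogonal to [one] is not shortened by [W], against
    [normF_weight_strict]. *)
Lemma second_singular_value_lt1 (sigma : R) : second_singular_value W sigma -> sigma < 1.
Proof.
move=> /second_singular_value_spectral[s0 [U [D [UU BE _ [i [j [ij Di Dj]]]]]]].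
rewrite ltNge; apply/negP => s1.
have s2 : 1 <= sigma ^+ 2 by rewrite expr_ge1.
have UU' := mulmx1C UU.
have [c [d [cd0 cd1]]] : exists c d, (c != 0) || (d != 0) /\
    c * (U *m one) i 0 + d * (U *m one) j 0 = 0.
  have [ui|ui] := eqVneq ((U *m one) i 0) 0.
    by exists 1, 0; rewrite oner_eq0 ui mulr0 mul0r addr0.
  exists ((U *m one) j 0), (- (U *m one) i 0).
  by rewrite oppr_eq0 ui orbT mulNr mulrC subrr.
pose z : 'cV[R]_N := c *: delta_mx i 0 + d *: delta_mx j 0.
have zk k : z k 0 = c * (k == i)%:R + d * (k == j)%:R by rewrite !mxE !andbT.
pose x := U^T *m z.
have Ux : U *m x = z by rewrite /x mulmxA UU' mul1mx.
have x1 : inner one x = 0.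
  rewrite /x inner_mulr trmxK inner_cV -[RHS]cd1.
  under eq_bigr do rewrite zk mulrDr.
  rewrite big_split /= (bigD1 i) //= big1 ?addr0 => [|k /negPf ->]; last by rewrite !mulr0.
  rewrite (bigD1 j) //= big1 ?addr0 => [|k /negPf ->]; last by rewrite !mulr0.
  by rewrite !eqxx !mulr1 ![_ * c]mulrC [_ * d]mulrC.
have : x = 0.
  apply: normF_weight_strict => //.
  rewrite -ler_sqr ?nnegrE ?normF_ge0 // sqr_normF_weight BE inner_diag Ux.
  rewrite /x sqr_normF inner_mull trmxK mulmxA UU' mul1mx inner_cV.
  apply: ler_sum => k _; rewrite -expr2 zk.
  have [->|ki] := eqVneq k i; first by rewrite ler_peMl ?sqr_ge0 // (le_trans s2).
  have [->|kj] := eqVneq k j; first by rewrite ler_peMl ?sqr_ge0 // (le_trans s2).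
  by rewrite !mulr0 addr0 expr0n mulr0.
move=> x0; have z0 : z = 0 by rewrite -Ux x0 mulmx0.
move: (zk i) (zk j); rewrite z0 !mxE !eqxx (negPf ij) eq_sym (negPf ij) !mulr0 !mulr1 add0r addr0.
by move=> c0 d0; move: cd0; rewrite -c0 -d0 eqxx.
Qed.

Lemma normF_weight_contract (sigma : R) y : second_singular_value W sigma ->
  inner one y = 0 -> normF (W *m y) <= sigma * normF y.
Proof.
move=> hs; have s1 := second_singular_value_lt1 hs.
have [s0 [U [D [UU BE Duniq _]]]] := second_singular_value_spectral hs => y1.
rewrite -ler_sqr ?nnegrE ?mulr_ge0 ?normF_ge0 // exprMn.
have sub x : (forall i, sigma ^+ 2 < D 0 i -> (U *m x) i 0 = 0) ->
    normF (W *m x) ^+ 2 <= sigma ^+ 2 * normF x ^+ 2.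
  move=> hx; rewrite sqr_normF_weight BE inner_diag.
  have -> : normF x ^+ 2 = inner (U *m x) (U *m x).
    by rewrite inner_mull mulmxA UU mul1mx sqr_normF.
  rewrite inner_cV mulr_sumr; apply: ler_sum => i _; rewrite -expr2.
  have [/hx ->|Di] := ltP (sigma ^+ 2) (D 0 i); first by rewrite expr0n !mulr0.
  by rewrite ler_wpM2r ?sqr_ge0.
have [/existsP[i Di]|/existsPn noD] := boolP [exists i, sigma ^+ 2 < D 0 i]; last first.
  by apply: sub => i Di; have := noD i; rewrite Di.
pose a := (U *m y) i 0; pose b := - (U *m one) i 0.
have [a0|a0] := eqVneq a 0.
  by apply: sub => j Dj; rewrite (Duniq _ _ Dj Di).
(* The combination of [1] and [y] orthogonal to the only eigenvector with
   eigenvalue above [sigma ^+ 2]. *)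
have := sub (a *: one + b *: y) => h.
have {h} /h : forall j, sigma ^+ 2 < D 0 j -> (U *m (a *: one + b *: y)) j 0 = 0.
  move=> j /(Duniq _ _ Di) <-; rewrite mulmxDr -!scalemxAr mxE.
  by rewrite [X in X + _]mxE [X in _ + X]mxE /a /b; ring.
have y1' : inner one (W *m y) = 0 by rewrite inner_mulr WT W1.
rewrite mulmxDr -!scalemxAr W1 !sqr_normFD !normFZ !exprMn !real_normK ?num_real //.
rewrite !innerZl !innerZr y1 y1' => h; rewrite leNgt; apply/negP => hlt.
have one0 : 0 < normF one ^+ 2.
  rewrite sqr_normF inner_cV; under eq_bigr do rewrite !mxE mulr1.
  by rewrite sumr_const card_ord.
(* The cross terms in [h] have vanished. Without contraction of [y], its part of [h] has the wrong
   sign, and the part of [one], fixed by [W], has it strictly since [sigma < 1]. *)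
have : 0 <= b ^+ 2 * (normF (W *m y) ^+ 2 - sigma ^+ 2 * normF y ^+ 2).
  by rewrite mulr_ge0 ?sqr_ge0 // subr_ge0 ltW.
have : 0 < a ^+ 2 * normF one ^+ 2 * (1 - sigma ^+ 2).
  apply: mulr_gt0; last by rewrite subr_gt0 expr_lt1.
  by apply: mulr_gt0 => //; rewrite lt0r sqrf_eq0 a0 sqr_ge0.
lra.
Qed.

Lemma normF_weight_pow_contract (sigma : R) t y : second_singular_value W sigma ->
  inner one y = 0 -> normF (W ^+ t *m y) <= sigma ^+ t * normF y.
Proof.
move=> hs y1; have [s0 _] := second_singular_value_spectral hs.
elim: t => [|t IHt]; first by rewrite !expr0 mul1mx mul1r.
rewrite !exprS -[W * _]/(W *m _) -mulmxA -mulrA.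
apply: le_trans (normF_weight_contract hs _) _; last by rewrite ler_wpM2l.
by rewrite inner_mulr weight_pow_sym weight_pow_one.
Qed.

Variables (sigma2 : R) (t : nat).
Hypotheses (hsigma : second_singular_value W sigma2) (t_ge1 : (1 <= t)%N).
Hypothesis ht : sigma2 != 0 ->
  Num.ceil (ln (1 / (2 * Num.sqrt N%:R)) / ln sigma2) <= t%:Z.

(** For [0 < sigma2 < 1] the condition on [t], multiplied by the negative [ln sigma2], reads
    [sigma2 ^+ t <= 1 / (2 * Num.sqrt N%:R)]. *)
Lemma sigma_pow_le : (sigma2 ^+ t) ^+ 2 <= (4 * N%:R)^-1.
Proof.
have [s0 _] := second_singular_value_spectral hsigma.
have s1 := second_singular_value_lt1 hsigma.
have sN : 0 < Num.sqrt (N%:R : R) by rewrite sqrtr_gt0.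
have c0 : 0 < 1 / (2 * Num.sqrt N%:R) :> R by rewrite divr_gt0 ?mulr_gt0.
have -> : (4 * N%:R)^-1 = (1 / (2 * Num.sqrt N%:R)) ^+ 2 :> R.
  rewrite div1r exprVn exprMn sqr_sqrtr ?ler0n //; congr (_ * _)^-1; ring.
rewrite ler_sqr ?nnegrE ?exprn_ge0 ?(ltW c0) //.
(* For [sigma2 = 0] the power vanishes because [t >= 1]. *)
have [->|sn0] := eqVneq sigma2 0.
  by rewrite expr0n eqn0Ngt t_ge1; exact: ltW.
have {}s0 : 0 < sigma2 by rewrite lt0r sn0.
have := ht sn0; rewrite ceil_le_int ler_ndivrMr ?ln_lt0 ?s0 // => h.
rewrite -ler_ln ?posrE ?exprn_gt0 // lnXn // -[_ *+ t]mulr_natl; exact: h.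
Qed.

Let K i j := (W ^+ t) i j - N%:R^-1.

(** [K] is [W ^+ t] minus averaging, so it acts on [y] as [W ^+ t] acts on the centered vector [z],
    where [normF_weight_pow_contract] applies. *)
Lemma weight_sub_mean_le y :
  \sum_i (\sum_j K i j * y j 0) ^+ 2 <= (4 * N%:R)^-1 * \sum_j y j 0 ^+ 2.
Proof.
pose m := N%:R^-1 * \sum_j y j 0; pose z := y - m *: one.
have z1 : inner one z = 0.
  rewrite inner_cV (eq_bigr (fun j => y j 0 - m)) => [|j _]; last by rewrite !mxE mul1r mulr1.
  by rewrite sumrB sumr_const card_ord -[m *+ N]mulr_natl /m mulVKf ?gt_eqF // subrr.
have Kz i : \sum_j K i j * y j 0 = (W ^+ t *m z) i 0.
  rewrite /z mulmxBr -scalemxAr weight_pow_one !mxE mulr1 /m mulr_sumr -sumrB.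
  by apply: eq_bigr => j _; rewrite /K mulrBl.
have zy : normF z ^+ 2 <= normF y ^+ 2.
  have -> : y = z + m *: one by rewrite subrK.
  by rewrite sqr_normFD innerZr innerC z1 !mulr0 addr0 lerDl sqr_ge0.
have E x : \sum_j x j 0 ^+ 2 = normF x ^+ 2 by rewrite sqr_normF inner_cV.
rewrite (eq_bigr _ (fun i _ => congr1 (fun a => a ^+ 2) (Kz i))) !E.
apply: le_trans (ler_pM (sqr_ge0 _) (sqr_ge0 _) sigma_pow_le zy).
rewrite -exprMn ler_sqr ?nnegrE ?mulr_ge0 ?exprn_ge0 ?normF_ge0 //.
  exact: normF_weight_pow_contract.
by have [] := second_singular_value_spectral hsigma.
Qed.

(** On a basis vector [weight_sub_mean_le] bounds the squared l2-norm of a row by [1 / (4 N)];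
    passing to the l1-norm costs a factor [N] in the square. *)
Lemma weight_row_dist i : \sum_j `|(W ^+ t) i j - N%:R^-1| <= 2^-1.
Proof.
have := weight_sub_mean_le (delta_mx i 0).
have -> : \sum_j (delta_mx i 0 : 'cV[R]_N) j 0 ^+ 2 = 1.
  rewrite (bigD1 i) //= big1 ?addr0 ?mxE ?eqxx ?expr1n //.
  by move=> j /negPf ji; rewrite mxE ji expr0n.
rewrite (eq_bigr (fun j => K i j ^+ 2)); last first.
  move=> j _; congr (_ ^+ 2); rewrite (bigD1 i) //= big1 ?addr0; last first.
    by move=> k /negPf ki; rewrite mxE ki mulr0.
  by rewrite mxE !eqxx mulr1 /K weight_pow_symE.
rewrite mulr1 => h.
rewrite -ler_sqr ?nnegrE ?invr_ge0 ?sumr_ge0 //.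
have := @jensen_sqr R _ (index_enum 'I_N) (fun=> N%:R^-1) (fun j => N%:R * `|K i j|).
rewrite sumr_const card_ord -[N%:R^-1 *+ N]mulr_natl mulfV ?gt_eqF // invr_ge0 ler0n.
move=> /(_ (fun=> isT) (lexx _)).
rewrite (eq_bigr (fun j => `|K i j|)) => [|j _]; last by rewrite mulKf ?gt_eqF.
move=> /le_trans; apply.
rewrite (eq_bigr (fun j => N%:R * K i j ^+ 2)) => [|j _]; last first.
  by rewrite exprMn real_normK ?num_real // expr2 -!mulrA mulKf ?gt_eqF.
rewrite -mulr_sumr.
apply: le_trans (ler_wpM2l (ler0n _ _) h) _.
by rewrite invfM mulrCA mulfV ?gt_eqF // mulr1 expr2 -invfM -natrM.
Qed.

(** The bound for vectors applies to each matrix entry separately, and [1 / (4 N) <= 1 / 8] because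
    [N >= 2]. *)
Lemma sum_weight_dist n r (a : 'I_N -> 'M[R]_(n, r)) :
  \sum_i normF (\sum_j (W ^+ t) i j *: a j - amean a) ^+ 2 <=
  8^-1 * \sum_j normF (a j) ^+ 2.
Proof.
have norm_entries (u : 'M[R]_(n, r)) : normF u ^+ 2 = \sum_p \sum_q u p q ^+ 2.
  by rewrite sqr_normF innerE.
rewrite (eq_bigr _ (fun i _ => norm_entries _)).
rewrite [in leRHS](eq_bigr _ (fun i _ => norm_entries _)).
rewrite exchange_big [X in _ * X]exchange_big mulr_sumr /=; apply: ler_sum => p _.
rewrite exchange_big [X in _ * X]exchange_big mulr_sumr /=; apply: ler_sum => q _.
have := weight_sub_mean_le (\col_j a j p q).
rewrite (eq_bigr (fun i => (\sum_j (W ^+ t) i j *: a j - amean a) p q ^+ 2)); last first.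
  move=> i _; congr (_ ^+ 2); rewrite mxE [X in _ + X]mxE !summxE [X in _ - X]mxE summxE.
  by rewrite mulr_sumr -sumrB; apply: eq_bigr => j _; rewrite !mxE mulrBl.
rewrite [X in _ <= _ * X](eq_bigr (fun j => a j p q ^+ 2)); last by move=> j _; rewrite mxE.
move=> /le_trans; apply; apply: ler_wpM2r.
  by apply: sumr_ge0 => j _; rewrite sqr_ge0.
rewrite lef_pV2 ?posrE ?mulr_gt0 //.
by rewrite -natrM ler_nat (@leq_mul 4 2).
Qed.

End Mixing.


(** * Invariance of the local region under one step *)

Section OneStep.
Variables (R : realType) (n r N : nat) (M : R) (w : 'M[R]_N).
Hypotheses (N_gt0 : (0 < N)%N) (M_gt0 : 0 < M) (hM : @second_order_retr R n r M).
Hypotheses (w_ge0 : forall i j, 0 <= w i j) (w_row : forall i, \sum_j w i j = 1)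
  (w_col : forall j, \sum_i w i j = 1)
  (w_dist : forall i, \sum_j `|w i j - N%:R^-1| <= 2^-1)
  (w_mix : forall a : 'I_N -> 'M[R]_(n, r),
    \sum_i normF (\sum_j w i j *: a j - amean a) ^+ 2 <= 8^-1 * \sum_j normF (a j) ^+ 2).
Variables (alpha delta1 delta2 : R).
Hypotheses (alpha_gt0 : 0 < alpha) (alpha_le1 : alpha <= 1) (alphaM : alpha * M <= 1).
Hypotheses (delta1_gt0 : 0 < delta1) (delta1_le : 5 * delta1 <= delta2)
  (delta2_le : delta2 <= 1 / 6).
Variables (X p : 'I_N -> 'M[R]_(n, r)) (Xh : 'M[R]_(n, r)).
Hypotheses (XS : forall i, St (X i)) (hXh : is_iam X Xh)
  (hX : near_iam delta1 delta2 X Xh).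
Hypotheses (p_tangent : forall i, tangent (X i) (p i))
  (p_le : forall i, normF (p i) <= alpha * (delta1 / 5)).

Let Z i := \sum_j w i j *: X j.
Let s i := alpha *: projT (X i) (Z i) - p i.
Let X' i := polar_retr (X i) (s i).
Let d i := normF (X i - Xh).
Let h i := 2^-1 * \sum_j w i j * normF (X i - X j) ^+ 2.
Let Q i := 2^-1 *: (X i *m \sum_j w i j *: ((X i - X j)^T *m (X i - X j))).

Let Nn0 : N%:R != 0 :> R. Proof. by rewrite pnatr_eq0 -lt0n. Qed.
Let XhS : St Xh. Proof. by case: hXh. Qed.
Let d_ge0 i : 0 <= d i. Proof. exact: normF_ge0. Qed.
Let d_le i : d i <= delta2. Proof. exact: hX.2. Qed.
Let sum_d : \sum_i d i ^+ 2 <= N%:R * delta1 ^+ 2. Proof. exact: hX.1. Qed.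

(** Rows of [w] sum to 1, so for Stiefel points the symmetric part of [(X i)^T *m Z i] is the
    identity minus half the weighted Gram matrix of the disagreements. Projecting adds only the
    quadratic correction [Q i]. *)
Lemma projT_mixing i : projT (X i) (Z i) = Z i - X i + Q i.
Proof.
rewrite /projT /Q.
have -> : \sum_j w i j *: ((X i - X j)^T *m (X i - X j)) =
    2%:M - ((X i)^T *m Z i + (Z i)^T *m X i).
  rewrite (eq_bigr (fun j => w i j *: 2%:M -
      w i j *: ((X i)^T *m X j + (X j)^T *m X i))) => [|j _]; last first.
    by rewrite gram_St_sub // scalerBr [X in _ - _ *: X]addrC.
  rewrite sumrB -scaler_suml w_row scale1r; congr (_ - _).
  rewrite mulmx_sumr raddf_sum mulmx_suml -big_split /=; apply: eq_bigr => j _.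
  by rewrite trmxZ -scalemxAr -scalemxAl scalerDr.
rewrite mulmxBr scalerBr mul_mx_scalar scalerA mulVf ?pnatr_eq0 // scale1r.
by rewrite addrA subrK.
Qed.

Lemma normF_mixing_normal i : normF (Q i) <= h i.
Proof.
rewrite /Q /h normFZ ger0_norm ?invr_ge0 // ler_pM2l ?invr_gt0 //.
have -> u : normF (X i *m u) = normF u :> R.
  by rewrite /normF inner_mull mulmxA XS mul1mx.
apply: le_trans (normF_sum _ _ _) _; apply: ler_sum => j _.
by rewrite normFZ ger0_norm // ler_wpM2l // normF_gram.
Qed.

Lemma dist_agents i j : normF (X i - X j) <= d i + d j.
Proof.
have -> : X i - X j = (X i - Xh) - (X j - Xh) by rewrite opprB addrA subrK.
exact: normFB.
Qed.

Let wd i := \sum_j w i j * d j.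
Let wd_ge0 i : 0 <= wd i.
Proof. by apply: sumr_ge0 => j _; rewrite mulr_ge0. Qed.

Lemma sum_wd : \sum_i wd i ^+ 2 <= \sum_i d i ^+ 2.
Proof.
apply: (@le_trans _ _ (\sum_i \sum_j w i j * d j ^+ 2)).
  by apply: ler_sum => i _; apply: jensen_sqr => //; rewrite w_row.
rewrite exchange_big; apply: ler_sum => j _.
by rewrite -mulr_suml w_col mul1r.
Qed.

Lemma row_sum_dist i : \sum_j w i j * (d i + d j) = d i + wd i.
Proof.
rewrite (eq_bigr (fun j => w i j * d i + w i j * d j)) => [|j _]; last exact: mulrDr.
by rewrite big_split /= -mulr_suml w_row mul1r.
Qed.

Lemma h_le i : h i <= delta2 * (d i + wd i).
Proof.
rewrite /h -row_sum_dist mulrC ler_pdivrMr // mulr_sumr mulr_suml.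
apply: ler_sum => j _.
have := dist_agents i j; have := normF_ge0 (X i - X j).
set x := normF _ => x0 xle.
have -> : delta2 * (w i j * (d i + d j)) * 2 = w i j * ((d i + d j) * (delta2 * 2)) by ring.
rewrite ler_wpM2l // expr2.
have : x * x <= (d i + d j) * (d i + d j) by rewrite ler_pM.
(* One factor of the square is replaced by [2 * delta2], which keeps the bound linear in the
   distances. *)
have : (d i + d j) * (d i + d j) <= (d i + d j) * (delta2 * 2).
  by rewrite ler_wpM2l ?addr_ge0 //; have := d_le i; have := d_le j; lra.
lra.
Qed.

Lemma sum_h : \sum_i h i <= 2 * (N%:R * delta1 ^+ 2).
Proof.
apply: le_trans (_ : _ <= \sum_i (d i ^+ 2 + \sum_j w i j * d j ^+ 2)) _.
  apply: ler_sum => i _; rewrite /h mulrC ler_pdivrMr // mulrDl.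
  have -> : d i ^+ 2 * 2 = \sum_j w i j * (d i ^+ 2 * 2) by rewrite -mulr_suml w_row mul1r.
  rewrite mulr_suml -big_split /=; apply: ler_sum => j _.
  have : w i j * normF (X i - X j) ^+ 2 <= w i j * (d i + d j) ^+ 2.
    by rewrite ler_wpM2l // ler_sqr ?nnegrE ?addr_ge0 ?normF_ge0 ?dist_agents.
  have : 0 <= w i j * (d i - d j) ^+ 2 by rewrite mulr_ge0 ?sqr_ge0.
  lra.
rewrite big_split /= exchange_big /=.
rewrite [X in _ + X](eq_bigr (fun j => d j ^+ 2)) => [|j _]; last first.
  by rewrite -mulr_suml w_col mul1r.
have := sum_d; lra.
Qed.

Lemma step_dist i : normF (X' i - Xh) <=
  (1 - alpha) * d i + alpha * (normF (Z i - amean X) + h i + (13 / 60) * delta1).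
Proof.
have s_tangent : tangent (X i) (s i).
  by apply: tangentD; [apply/tangentZ/tangent_projT | rewrite -scaleN1r; exact: tangentZ].
apply: le_trans (polar_retr_nonexpansive (XS i) s_tangent XhS) _.
have -> : X i + s i - Xh = (1 - alpha) *: (X i - Xh) +
    (alpha *: ((Z i - amean X) + Q i + (amean X - Xh)) - p i).
  rewrite [s i]/(_ - p i) projT_mixing; move: (Z i) (Q i) (amean X) => z q m.
  apply/matrixP => a b; rewrite !mxE; ring.
apply: le_trans (normFD _ _) _; apply: lerD.
  by rewrite normFZ ger0_norm ?subr_ge0.
apply: le_trans (normFB _ _) _; rewrite normFZ (ger0_norm (ltW alpha_gt0)).
have := p_le i; have := normF_mixing_normal i.
have := iam_amean_dist N_gt0 M_gt0 hM XS hXh hX.1.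
have : normF (Z i - amean X + Q i + (amean X - Xh)) <=
    normF (Z i - amean X) + normF (Q i) + normF (amean X - Xh).
  by apply: le_trans (normFD _ _) _; rewrite lerD2r normFD.
move=> h1 h2 h3 h4.
apply: (@le_trans _ _ (alpha * (normF (Z i - amean X) + h i + delta1 ^+ 2 / 2) +
    alpha * (delta1 / 5))).
  by apply: lerD => //; rewrite ler_pM2l //; lra.
rewrite -mulrDr ler_pM2l //.
(* Then [delta1 ^+ 2 / 2 <= delta1 / 60], and [1 / 60 + 1 / 5 = 13 / 60]. *)
have : delta1 ^+ 2 <= delta1 * (1 / 30) by rewrite expr2 ler_pM2l //; have := delta1_le; have := delta2_le; lra.
lra.
Qed.

Lemma sum_step_dist : \sum_i normF (X' i - Xh) ^+ 2 <= N%:R * delta1 ^+ 2.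
Proof.
(* Jensen on the four terms of the bound with weights [3 / 8], [1 / 6], [1 / 6], [13 / 60], of total
   below 1; the weight [3 / 8] of the mixing error produces the factor [8 / 3]. *)
pose B i := (1 - alpha) * d i ^+ 2 + alpha *
  (8 / 3 * normF (Z i - amean X) ^+ 2 + 6^-1 * (d i ^+ 2 + wd i ^+ 2) + 13 / 60 * delta1 ^+ 2).
apply: (@le_trans _ _ (\sum_i B i)).
  apply: ler_sum => i _.
  have hd := step_dist i.
  set z := normF (Z i - amean X) in hd *; rewrite /B -/z.
  have hh : h i <= 6^-1 * (d i + wd i).
    by apply: le_trans (h_le i) _; rewrite ler_wpM2r ?addr_ge0 //; have := delta2_le; lra.
  pose m := z + 6^-1 * (d i + wd i) + 13 / 60 * delta1.
  have z0 : 0 <= z by exact: normF_ge0.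
  have {}hd : normF (X' i - Xh) <= (1 - alpha) * d i + alpha * m.
    by apply: le_trans hd _; rewrite lerD2l ler_pM2l // /m; lra.
  have m2 : m ^+ 2 <= 8 / 3 * z ^+ 2 + 6^-1 * (d i ^+ 2 + wd i ^+ 2) + 13 / 60 * delta1 ^+ 2.
    have := sqr_ge0 (8 / 3 * z - d i); have := sqr_ge0 (8 / 3 * z - wd i).
    have := sqr_ge0 (8 / 3 * z - delta1); have := sqr_ge0 (d i - wd i).
    have := sqr_ge0 (d i - delta1); have := sqr_ge0 (wd i - delta1).
    have := sqr_ge0 z; have := sqr_ge0 (d i); have := sqr_ge0 (wd i).
    have := sqr_ge0 delta1; rewrite /m; lra.
  apply: (@le_trans _ _ (((1 - alpha) * d i + alpha * m) ^+ 2)).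
    have b0 := le_trans (normF_ge0 _) hd.
    by rewrite ler_sqr ?nnegrE ?normF_ge0.
  apply: (@le_trans _ _ ((1 - alpha) * d i ^+ 2 + alpha * m ^+ 2)).
    have : 0 <= alpha * (1 - alpha) * (d i - m) ^+ 2.
      by rewrite mulr_ge0 ?sqr_ge0 // mulr_ge0 ?subr_ge0 // ltW.
    lra.
  by rewrite lerD2l ler_pM2l.
rewrite /B big_split /= -!mulr_sumr !big_split /= -!mulr_sumr big_split /=.
rewrite sumr_const card_ord -[delta1 *+ N]mulr_natl [delta1 * _]mulrCA -expr2.
(* Subtracting [Xh] from every agent leaves [Z i - amean X] unchanged. *)
have mixD : \sum_i normF (Z i - amean X) ^+ 2 <= 8^-1 * \sum_i d i ^+ 2.
  apply: le_trans (w_mix (fun i => X i - Xh)); rewrite le_eqVlt; apply/orP; left.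
  apply/eqP/eq_bigr => i _; congr (normF _ ^+ 2).
  rewrite -ameanB amean_const // opprB addrA; congr (_ - _).
  rewrite (eq_bigr (fun j => w i j *: X j - w i j *: Xh)) => [|j _]; last exact: scalerBr.
  by rewrite sumrB -scaler_suml w_row scale1r subrK.
have := sum_wd; have := sum_d; set D := \sum_i d i ^+ 2 in mixD *.
set C := N%:R * _ => DC wdD.
have : (1 - alpha) * D <= (1 - alpha) * C by rewrite ler_wpM2l ?subr_ge0.
(* The total coefficient is [1 / 3 + 1 / 3 + 13 / 60 = 53 / 60]. *)
have : alpha * (8 / 3 * \sum_i normF (Z i - amean X) ^+ 2 +
    6^-1 * (D + \sum_i wd i ^+ 2) + 13 / 60 * C) <= alpha * C.
  have C0 : 0 <= C by rewrite mulr_ge0 ?ler0n ?sqr_ge0.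
  by rewrite ler_pM2l //; lra.
lra.
Qed.

Lemma sup_step_dist i :
  normF (X' i - Xh) <= (1 - alpha) * delta2 + alpha * (5 / 6 * delta2 + 13 / 60 * delta1).
Proof.
apply: le_trans (step_dist i) _; apply: lerD.
  by rewrite ler_wpM2l ?subr_ge0.
rewrite ler_pM2l // lerD2r.
have d20 : 0 <= delta2 by exact: le_trans (d_ge0 i) (d_le i).
(* The coefficients [w i j - 1 / N] sum to zero along a row, so [Xh] can be subtracted before the
   l1-bound is used. With [hle] this gives [1 / 2 + 1 / 3 = 5 / 6]. *)
have zle : normF (Z i - amean X) <= 2^-1 * delta2.
  have -> : Z i - amean X = \sum_j (w i j - N%:R^-1) *: (X j - Xh).
    rewrite (eq_bigr (fun j => (w i j *: X j - N%:R^-1 *: X j) -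
        (w i j *: Xh - N%:R^-1 *: Xh))) => [|j _]; last first.
      by rewrite scalerBr !scalerBl.
    rewrite !sumrB -!scaler_suml w_row sumr_const card_ord -[N%:R^-1 *+ N]mulr_natl.
    by rewrite mulfV // subrr subr0 -scaler_sumr.
  apply: le_trans (normF_sum _ _ _) _.
  apply: (@le_trans _ _ (\sum_j `|w i j - N%:R^-1| * delta2)).
    by apply: ler_sum => j _; rewrite normFZ ler_wpM2l //; exact: d_le.
  by rewrite -mulr_suml ler_wpM2r.
have hle : h i <= 3^-1 * delta2.
  apply: le_trans (h_le i) _.
  have : wd i <= delta2.
    rewrite -[leRHS]mul1r -(w_row i) mulr_suml.
    by apply: ler_sum => j _; rewrite ler_wpM2l.
  have := d_le i => hd hwd.
  have : delta2 * (d i + wd i) <= delta2 * (1 / 3) by rewrite ler_wpM2l //; have := delta2_le; lra.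
  lra.
lra.
Qed.

(** The linear parts [Z i - X i] sum to zero because the columns of [w] sum to 1. Only the
    retraction error, the correction [Q i] and the step [p i] move the Euclidean mean. *)
Lemma amean_step : normF (amean X - amean X') <=
  alpha * (252 / 25 * delta1 ^+ 2 + delta1 / 5).
Proof.
have s_tangent i : tangent (X i) (s i).
  by apply: tangentD; [apply/tangentZ/tangent_projT | rewrite -scaleN1r; exact: tangentZ].
have ZX i : normF (Z i - X i) <= d i + wd i.
  have -> : Z i - X i = \sum_j w i j *: (X j - X i).
    rewrite (eq_bigr (fun j => w i j *: X j - w i j *: X i)) => [|j _]; last exact: scalerBr.
    by rewrite sumrB -scaler_suml w_row scale1r.
  rewrite -row_sum_dist; apply: le_trans (normF_sum _ _ _) _; apply: ler_sum => j _.
  by rewrite normFZ ger0_norm // ler_wpM2l // normF_distC dist_agents.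
have sumZX : \sum_i (Z i - X i) = 0.
  rewrite sumrB exchange_big /= (eq_bigr X) ?subrr // => j _.
  by rewrite -scaler_suml w_col scale1r.
have sle i : M * normF (s i) ^+ 2 <=
    alpha * (4 * d i ^+ 2 + 4 * wd i ^+ 2 + 2 / 25 * delta1 ^+ 2).
  have : normF (s i) <= alpha * (d i + wd i + delta1 / 5).
    rewrite mulrDr; apply: le_trans (normFB _ _) _; apply: lerD => //.
    rewrite normFZ (ger0_norm (ltW alpha_gt0)) ler_pM2l //.
    rewrite -[projT _ _]subr0 -(projT_id (XS i)) -projTB.
    exact: le_trans (normF_projT _ (XS i)) (ZX i).
  set q := d i + wd i + _ => sq.
  have q0 : 0 <= q by apply: addr_ge0; [exact: addr_ge0 | rewrite divr_ge0 // ltW].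
  have q2 : q ^+ 2 <= 4 * d i ^+ 2 + 4 * wd i ^+ 2 + 2 / 25 * delta1 ^+ 2.
    have := sqr_ge0 (d i - wd i); have := sqr_ge0 (d i + wd i - delta1 / 5).
    rewrite /q; lra.
  apply: le_trans (_ : _ <= alpha * q ^+ 2) _; last by rewrite ler_pM2l.
  have : normF (s i) ^+ 2 <= alpha ^+ 2 * q ^+ 2.
    by rewrite -exprMn ler_sqr ?nnegrE ?normF_ge0 // mulr_ge0 // ltW.
  rewrite -(ler_pM2l M_gt0) => /le_trans; apply.
  (* The condition [alpha <= 1 / M] absorbs [M] and leaves one factor [alpha]. *)
  have : alpha * M * (alpha * q ^+ 2) <= 1 * (alpha * q ^+ 2).
    by rewrite ler_wpM2r // mulr_ge0 ?sqr_ge0 // ltW.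
  lra.
have -> : amean X - amean X' = - amean (fun i => (X' i - (X i + s i)) + (alpha *: Q i - p i)).
  rewrite -opprB ameanB; congr (- _); rewrite /amean; congr (_ *: _).
  apply/eqP; rewrite -subr_eq0 -sumrB -[X in X == _]opprK.
  rewrite -sumrN (eq_bigr (fun i => - alpha *: (Z i - X i))) => [|i _].
    by rewrite -scaler_sumr sumZX scaler0 oppr0.
  rewrite [s i]/(_ - p i) projT_mixing; apply/matrixP => a b; rewrite !mxE; ring.
rewrite normFN; apply: le_trans (normF_amean N_gt0 _) _.
rewrite mulrC ler_pdivrMr ?ltr0n //.
apply: (@le_trans _ _ (\sum_i (alpha * (4 * d i ^+ 2 + 4 * wd i ^+ 2 + 2 / 25 * delta1 ^+ 2)
    + (alpha * h i + alpha * (delta1 / 5))))).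
  apply: ler_sum => i _; apply: le_trans (normFD _ _) _; apply: lerD.
    exact: le_trans (hM (XS i) (s_tangent i)) (sle i).
  apply: le_trans (normFB _ _) _; apply: lerD => //.
  by rewrite normFZ (ger0_norm (ltW alpha_gt0)) ler_pM2l // normF_mixing_normal.
have cst (c : R) : \sum_(i < N) c = N%:R * c by rewrite sumr_const card_ord mulr_natl.
rewrite [leLHS](_ : _ = alpha * (4 * \sum_i d i ^+ 2 + 4 * \sum_i wd i ^+ 2 +
    2 / 25 * (N%:R * delta1 ^+ 2)) + (alpha * \sum_i h i + alpha * (N%:R * (delta1 / 5)))).
  have := sum_wd; have := sum_d; have := sum_h.
  set D := \sum_i d i ^+ 2; set E := \sum_i wd i ^+ 2; set H := \sum_i h i => hH hD hE.
  (* Here [4 + 4 + 2 = 10]; the remaining [2 / 25] completes [252 / 25]. *)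
  have : alpha * (4 * D + 4 * E + H) <= alpha * (10 * (N%:R * delta1 ^+ 2)).
    by rewrite ler_pM2l //; lra.
  lra.
rewrite big_split /= -mulr_sumr; congr (_ * _ + _).
  by rewrite !big_split /= cst -!mulr_sumr; ring.
by rewrite big_split /= cst -mulr_sumr; ring.
Qed.

(** Both thresholds are first obtained around the old [Xh]. The quadratic one passes to the new IAM
    by minimality, the maximum by adding the drift of the IAM. *)
Lemma one_step : local_region delta1 delta2 X'.
Proof.
have X'S i : St (X' i).
  apply: polar_retr_St => //.
  by apply: tangentD; [apply/tangentZ/tangent_projT | rewrite -scaleN1r; exact: tangentZ].
have d30 : delta1 <= 1 / 30 by have := delta1_le; have := delta2_le; lra.
have dsq : delta1 ^+ 2 <= delta1 * (1 / 30) by rewrite expr2 ler_pM2l.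
have d1 : delta1 ^+ 2 < 1 by lra.
have [Xh' hXh'] := iam_exists N_gt0 X'S XhS sum_step_dist d1.
have sum' : \sum_i normF (X' i - Xh') ^+ 2 <= N%:R * delta1 ^+ 2.
  apply: le_trans sum_step_dist.
  rewrite (eq_bigr _ (fun i _ => congr1 (fun a => a ^+ 2) (normF_distC _ _))).
  rewrite [leRHS](eq_bigr _ (fun i _ => congr1 (fun a => a ^+ 2) (normF_distC _ _))).
  exact: hXh'.2.
split=> //; exists Xh' => //; split=> // i.
have := iam_lipschitz N_gt0 M_gt0 hM XS X'S hXh hXh' hX.1 sum'.
have := amean_step => h1 /le_trans/(_ h1).
have := sup_step_dist i.
have -> : X' i - Xh' = (X' i - Xh) + (Xh - Xh') by rewrite addrA subrK.
have := normFD (X' i - Xh) (Xh - Xh').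
set T := normF (Xh - Xh'); have T0 : 0 <= T by exact: normF_ge0.
have cT : 1799 / 1800 * T <= (1 - delta1 ^+ 2 / 2) * T by rewrite ler_wpM2r //; lra.
(* From [delta1 <= 1 / 30]: [252 / 750 + 1 / 5 = 134 / 250]. Even after division by [1799 / 1800]
   and with [13 / 60] added, this stays below the margin [delta2 / 6 >= 5 / 6 * delta1]. *)
have : alpha * (252 / 25 * delta1 ^+ 2 + delta1 / 5) <= alpha * (134 / 250 * delta1).
  by rewrite ler_pM2l //; lra.
have : alpha * (5 * delta1) <= alpha * delta2 by rewrite ler_pM2l.
have : 0 <= alpha * delta1 by rewrite mulr_ge0 ?ltW.
lra.
Qed.
End OneStep.


(** * Constants, samples in the supports, and the induction along the iterates *)

(** A set without supremum has [sup] equal to the default 0. *)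
Lemma sup_nneg (R : realType) (A : set R) : (forall x, A x -> 0 <= x) -> 0 <= sup A.
Proof.
move=> A0; have [hA|/sup_out -> //] := pselect (has_sup A).
have [[x Ax] _] := hA; apply: le_trans (A0 _ Ax) _.
by move/ubP: (sup_upper_bound hA); exact.
Qed.

Lemma max_grad_norm2_ge0 (R : realType) n r N (f : 'I_N -> 'M[R]_(n, r) -> R) :
  0 <= max_grad_norm2 f.
Proof.
apply: sup_nneg => _ [q _ <-]; apply: sup_nneg => _ [x _ <-]; exact: normF_ge0.
Qed.

Lemma L_smooth_ge0 (R : realType) n r (L : R) (f : 'M[R]_(n, r) -> R) :
  (0 < n)%N -> (0 < r)%N -> L_smooth L f -> 0 <= L.
Proof.
move=> n0 r0 [_ /(_ (const_mx 1) 0)]; rewrite subr0.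
have c0 : 0 < normF (const_mx 1 : 'M[R]_(n, r)).
  rewrite lt0r normF_ge0 normF_eq0 andbT; apply/eqP.
  move=> /matrixP/(_ (Ordinal n0) (Ordinal r0)); rewrite !mxE.
  by apply/eqP; rewrite oner_eq0.
by move/(le_trans (normF_ge0 _)); rewrite pmulr_lge0.
Qed.

Lemma normF_batch_grad (R : realType) n r N (d : 'I_N -> measure_display)
    (Xi : forall i, measurableType (d i)) (Omega : Type) (Nk : nat -> nat)
    (smp : forall i : 'I_N, nat -> nat -> Omega -> Xi i)
    (G : forall i, 'M[R]_(n, r) -> Xi i -> 'M[R]_(n, r)) (C : R) w k i Y :
  (0 < Nk k)%N -> (forall j, (j < Nk k)%N -> normF (G i Y (smp i k j w)) <= C) ->
  normF ((Nk k)%:R^-1 *: \sum_(j < Nk k) G i Y (smp i k j w)) <= C.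
Proof.
move=> Nk0 GC; rewrite normFZ ger0_norm ?invr_ge0 ?ler0n // ler_pdivrMl ?ltr0n //.
apply: le_trans (normF_sum _ _ _) _.
apply: (@le_trans _ _ (\sum_(j < Nk k) C)); first by apply: ler_sum => j _; exact: GC.
by rewrite sumr_const card_ord mulr_natl.
Qed.

(** Each sample is almost surely in its support, and there are countably many indices. *)
Lemma ae_samples_in_support (R : realType) N (d : 'I_N -> measure_display)
    (Xi : forall i, measurableType (d i)) (law : forall i, probability (Xi i) R)
    (supp : forall i, set (Xi i)) (d0 : measure_display) (Omega : measurableType d0)
    (P : probability Omega R) (Nk : nat -> nat)
    (smp : forall i : 'I_N, nat -> nat -> Omega -> Xi i) :
  (forall i, measurable (supp i) /\ law i (supp i) = 1%E) ->
  iid_samples law P Nk smp ->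
  {ae P, forall w, forall i k j, (j < Nk k)%N -> supp i (smp i k j w)}.
Proof.
move=> hsupp [smp_meas smp_law _].
apply: filter_forall => i; apply: ae_foralln => k; apply: ae_foralln => j.
have [jk|jk] := boolP (j < Nk k)%N; last exact: nearW.
have [ms ls] := hsupp i.
have mpre : measurable (smp i k j @^-1` supp i).
  by rewrite -[_ @^-1` _]setTI; exact: smp_meas.
apply: (@negligibleS _ _ _ _ (~` (smp i k j @^-1` supp i))).
  by move=> w /= h hs; apply: h => _.
apply/negligibleP; first exact: measurableC.
by apply: etrans (probability_setC P mpre) _; rewrite smp_law // ls subee.
Qed.

Theorem lemma10 (R : realType) (n r N : nat)
  (r_gt0 : (0 < r)%N) (r_le_n : (r <= n)%N) (N_gt1 : (1 < N)%N)
  (* retraction constant *)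
  (M : R) (M_gt0 : 0 < M) (hM : @second_order_retr R n r M)
  (* problem *)
  (d : 'I_N -> measure_display) (Xi : forall i, measurableType (d i))
  (law : forall i, probability (Xi i) R)
  (F : forall i, 'M[R]_(n, r) -> Xi i -> R) (f : 'I_N -> 'M[R]_(n, r) -> R)
  (hF : expected_objective law F f)
  (L : R) (hL : forall i, L_smooth L (f i))
  (LG : R) (hLG : LG = L + 2 * max_grad_norm2 f)
  (* network *)
  (e : rel 'I_N) (he : connected_graph e)
  (W : 'M[R]_N) (hW : weight_matrix e W)
  (sigma2 : R) (hsigma2 : second_singular_value W sigma2)
  (t : nat) (t_ge1 : (1 <= t)%N)
  (ht : sigma2 != 0 ->
    Num.ceil (ln (1 / (2 * Num.sqrt N%:R)) / ln sigma2) <= t%:Z)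
  (sigmaN : R) (hsigmaN : smallest_eigenvalue (W ^+ t) sigmaN)
  (Lt : R) (hLt : Lt = 1 - sigmaN)
  (* local region *)
  (delta1 delta2 : R) (delta1_gt0 : 0 < delta1) (delta2_gt0 : 0 < delta2)
  (hdelta1 : delta1 <= 1 / (5 * Num.sqrt r%:R) * delta2)
  (hdelta2 : delta2 <= 1 / 6)
  (Phi : R) (Phi_ge1 : 1 <= Phi)
  (hPhi : forall (X : 'I_N -> 'M[R]_(n, r)) (Xh : 'M[R]_(n, r)),
    local_region delta1 delta2 X -> is_iam X Xh ->
    forall i, Phi <= 2 - normF (X i - Xh) ^+ 2)
  (* stochastic oracle *)
  (G : forall i, 'M[R]_(n, r) -> Xi i -> 'M[R]_(n, r))
  (supp : forall i, set (Xi i)) (sigma A1 : R)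
  (hG : oracle law f G supp sigma A1)
  (A2 : R) (hA2 : forall i X, St X -> normF (egrad (f i) X) <= A2)
  (A : R) (hA : A = Num.max A1 A2)
  (* sampling *)
  (d0 : measure_display) (Omega : measurableType d0) (P : probability Omega R)
  (Nk : nat -> nat) (Nk_gt0 : forall k, (0 < Nk k)%N)
  (smp : forall i : 'I_N, nat -> nat -> Omega -> Xi i)
  (hsmp : iid_samples law P Nk smp)
  (* step sizes *)
  (alpha : R) (alpha_gt0 : 0 < alpha)
  (halpha : alpha <= Num.min 1 (Num.min (1 / M) (Phi / Lt)))
  (rho : R)
  (hrho : rho = Num.sqrt (1 - (alpha * Lt * Phi - alpha ^+ 2 * Lt ^+ 2)))
  (beta : R) (beta_ge0 : 0 <= beta)
  (hbeta : beta <= Num.min ((1 - rho) / (10 * A + LG) * delta1)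
                           (alpha * delta1 / (5 * (10 * A + LG))))
  (* initial point *)
  (X0 : 'I_N -> 'M[R]_(n, r)) (hX0 : local_region delta1 delta2 X0) :
  let XY := iterate Nk smp G (W ^+ t) alpha beta X0 in
  let good w := forall k : nat,
    local_region delta1 delta2 (XY w k).1 /\
    forall i, normF ((XY w k).2 i) <= 10 * A + LG in
  (* for every realization with samples in the supports ... *)
  (forall w, (forall i k j, (j < Nk k)%N -> supp i (smp i k j w)) -> good w) /\
  (* ... hence with probability one *)
  {ae P, forall w, good w}.

Proof.
move=> XY good.
have i0 : 'I_N by exact: Ordinal (ltnW N_gt1).
have A1A : A1 <= A by rewrite hA le_max lexx.
have A0 : 0 <= A.
  rewrite hA; apply: le_trans (normF_ge0 (egrad (f i0) (X0 i0))) _.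
  by rewrite le_max (hA2 i0 _ (hX0.1 i0)) orbT.
have LG0 : 0 <= LG.
  have := L_smooth_ge0 (leq_trans r_gt0 r_le_n) r_gt0 (hL i0).
  by have := max_grad_norm2_ge0 f; rewrite hLG; lra.
have C0 : 0 <= 10 * A + LG by lra.
(* Mixing leaves half of the bound on [Y]; the mean of [Y] and two batch gradients, each at most
   [A], must fit in the other half. *)
have AC : 3 * A <= (10 * A + LG) / 2 by lra.
set C := 10 * A + LG in hbeta good C0 AC *.
have N_gt0 : (0 < N)%N by exact: ltnW.
have mixing_row := weight_row_dist N_gt1 he hW hsigma2 t_ge1 ht.
have mixing_sum := sum_weight_dist N_gt1 he hW hsigma2 t_ge1 ht.
have alpha_le1 : alpha <= 1 by move: halpha; rewrite le_min => /andP[].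
have alphaM : alpha * M <= 1.
  by move: halpha; rewrite !le_min => /and3P[_ h _]; rewrite -ler_pdivlMr.
have delta1_le : 5 * delta1 <= delta2.
  have sr : 1 <= Num.sqrt (r%:R : R) by rewrite -{1}sqrtr1 ler_wsqrtr // ler1n.
  have : 1 / (5 * Num.sqrt r%:R) * delta2 <= 1 / 5 * delta2.
    by rewrite ler_wpM2r ?(ltW delta2_gt0) // !div1r lef_pV2 ?posrE; lra.
  by have := hdelta1; lra.
have betaC : beta * C <= alpha * (delta1 / 5).
  (* The case [C = 0], where [hbeta] divides by zero, is treated apart. *)
  have := C0; rewrite le_eqVlt => /orP[/eqP <-|Cpos].
    by rewrite mulr0 !mulr_ge0 ?invr_ge0 // ltW.
  move: hbeta; rewrite le_min => /andP[_].
  rewrite ler_pdivlMr ?mulr_gt0 //; lra.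
have main w : (forall i k j, (j < Nk k)%N -> supp i (smp i k j w)) -> good w.
  move=> hw.
  pose g k i Y := batch_grad Nk smp G w k i Y.
  have gA k i Y : St Y -> normF (g k i Y) <= A.
    move=> YS; apply: (@normF_batch_grad R n r N d Xi Omega Nk smp G A w k i Y) => // j jk; apply: le_trans A1A.
    by apply: (oracle_bounded hG) => //; exact: hw.
  (* Gradient tracking: [W ^+ t] preserves means, so the mean of [Y] telescopes to the mean of the
     current batch gradients and is at most [A] for every [k]. The bound on [Y] limits the next move
     of [X], and the new [X] on the manifold bounds the next gradients. *)
  suff inv k : [/\ local_region delta1 delta2 (XY w k).1,
      forall i, normF ((XY w k).2 i) <= C &
      amean (XY w k).2 = amean (fun i => g k i ((XY w k).1 i))].
    by move=> k; have [] := inv k.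
  elim: k => [|k [hX hY hm]].
    split=> // i; apply: le_trans (gA 0%N i _ (hX0.1 i)) _; lra.
  have [XS [Xh hXh hnear]] := hX.
  set X := (XY w k).1 in hX hm XS hXh hnear; set Y := (XY w k).2 in hY hm.
  have hX' : local_region delta1 delta2 (XY w k.+1).1.
    apply: (one_step N_gt0 M_gt0 hM (weight_pow_ge0 hW t) (weight_pow_row_sum hW t)
      (weight_pow_col_sum hW t) mixing_row (@mixing_sum n r) alpha_gt0 alpha_le1 alphaM
      delta1_gt0 delta1_le hdelta2 XS hXh hnear) => i.
      exact/tangentZ/tangent_projT.
    rewrite normFZ ger0_norm //; apply: le_trans betaC; rewrite ler_wpM2l //.
    exact: le_trans (normF_projT _ (XS i)) (hY i).
  have gX' i : normF (g k.+1 i ((XY w k.+1).1 i)) <= A by exact: gA (hX'.1 i).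
  have YE i : (XY w k.+1).2 i = \sum_j (W ^+ t) i j *: Y j
      + g k.+1 i ((XY w k.+1).1 i) - g k i (X i) by [].
  have meanY : normF (amean Y) <= A.
    rewrite hm; apply: le_trans (normF_amean N_gt0 _) _.
    rewrite ler_pdivrMl ?ltr0n //; apply: (@le_trans _ _ (\sum_(i < N) A)).
      by apply: ler_sum => i _; exact: gA.
    by rewrite sumr_const card_ord mulr_natl.
  split=> // [i|].
    rewrite YE.
    have dY : normF (\sum_j (W ^+ t) i j *: Y j - amean Y) <= 2^-1 * C.
      have -> : \sum_j (W ^+ t) i j *: Y j - amean Y =
          \sum_j ((W ^+ t) i j - N%:R^-1) *: Y j.
        rewrite /amean scaler_sumr -sumrB; apply: eq_bigr => j _; exact: esym (scalerBl _ _ _).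
      apply: le_trans (normF_sum _ _ _) _.
      apply: (@le_trans _ _ (\sum_j `|(W ^+ t) i j - N%:R^-1| * C)).
        by apply: ler_sum => j _; rewrite normFZ ler_wpM2l.
      by rewrite -mulr_suml ler_wpM2r.
    have := normFB (\sum_j (W ^+ t) i j *: Y j + g k.+1 i ((XY w k.+1).1 i)) (g k i (X i)).
    have := normFD (\sum_j (W ^+ t) i j *: Y j) (g k.+1 i ((XY w k.+1).1 i)).
    have := normFD (\sum_j (W ^+ t) i j *: Y j - amean Y) (amean Y); rewrite subrK.
    have := gX' i; have := gA k i _ (XS i).
    lra.
  have -> : amean (XY w k.+1).2 = amean (fun i => \sum_j (W ^+ t) i j *: Y j)
      + amean (fun i => g k.+1 i ((XY w k.+1).1 i)) - amean (fun i => g k i (X i)).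
    by rewrite /amean -scalerDr -scalerBr -big_split -sumrB; congr (_ *: _).
  have -> : amean (fun i => \sum_j (W ^+ t) i j *: Y j) = amean Y.
    rewrite /amean exchange_big /=; congr (_ *: _).
    by apply: eq_bigr => j _; rewrite -scaler_suml (weight_pow_col_sum hW) scale1r.
  by rewrite hm addrAC subrr add0r.
split=> //.
have := ae_samples_in_support (supp_full hG) hsmp.
by apply: filterS => w /main.
Qed.
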